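(* Let $(S,T)$ be an ideally triangulated punctured surface of negative Euler characteristic, with set of ideal vertices $V$ and set of edges $E$. Then for every $h\in\mathbb{R}$ the map $\Psi_h\colon T_c(S)\times\mathbb{R}_{>0}^V\to\mathbb{R}^E$, defined by $$\Psi_h(d,r)(e)=\int_0^{\frac{b+c-a}{2}}e^{ht^2}\,dt+\int_0^{\frac{b'+c'-a'}{2}}e^{ht^2}\,dt$$ (where $a,a'$ are the generalized angles facing $e$, and $b,c$ and $b',c'$ are the generalized angles adjacent to $e$, in the two triangles adjacent to $e$), is a smooth embedding.
   Context: Ideally triangulated punctured surface: let $\overline{T}$ be a triangulation of a closed surface $\overline{S}$ with sets of vertices, edges and triangles $V,E,F$. Then $T=\{\sigma-V : \sigma\in F\}$ is an ideal triangulation of the punctured surface $S=\overline{S}-V$, and $V$ is the set of ideal vertices (cusps) of $S$. Decorated Teichmüller space: $T_c(S)$ is the Teichmüller space of complete hyperbolic metrics with cusp ends on $S$. A decorated hyperbolic metric $(d,r)\in T_c(S)\times\mathbb{R}_{>0}^V$ is a hyperbolic metric $d$ (up to equivalence) such that each cusp $v$ carries a horodisk $B_v$ centered at $v$ whose boundary $\partial B_v$ has length $r_v$ (for large $r_v$ the horodisks may overlap; they are understood in the universal cover). The space $T_c(S)\times\mathbb{R}_{>0}^V$ is the decorated Teichmüller space. Decorated ideal triangles: a decorated ideal triangle is an ideal triangle in $\mathbb{H}^2$ each of whose ideal vertices $v$ is equipped with a horodisk $B_v$ centered at $v$. Its generalized angle at $v$ is the length of the part of $\partial B_v$ lying in the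 cusp region bounded by the two edges at $v$. The generalized edge length of an edge with ideal vertices $u,v$ is the signed hyperbolic distance along the edge between its intersections with $\partial B_u$ and $\partial B_v$ (zero or negative if $B_u\cap B_v\neq\emptyset$). For $(d,r)$, each triangle of $T$ (realized with geodesic edges) becomes a decorated ideal triangle; the generalized edge length $l_{d,r}(e)$ of $e\in E$ does not depend on the adjacent triangle used. The length map $(d,r)\mapsto l_{d,r}$ is a diffeomorphism $T_c(S)\times\mathbb{R}_{>0}^V\to\mathbb{R}^E$ (Penner), which describes the smooth structure. In a decorated ideal triangle with edge lengths $l_1,l_2,l_3$, the generalized angle opposite the $i$-th edge is $\theta_i=e^{(l_i-l_j-l_k)/2}$, $\{i,j,k\}=\{1,2,3\}$. A generalized angle of a triangle faces an edge if it is opposite to it, and is adjacent to an edge if its vertex is an endpoint of that edge. Each edge $e$ is adjacent to two triangles of $T$ (possibly the same one, counted once for each side). *)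

(* Defs.v *)
From HB Require Import structures.
From mathcomp Require Import all_boot all_order all_algebra all_fingroup.
From mathcomp Require Import generic_quotient.
From mathcomp Require Import all_classical all_reals all_analysis.

Set Implicit Arguments.
Unset Strict Implicit.
Unset Printing Implicit Defensive.

Import Order.TTheory GRing.Theory Num.Theory.
Import numFieldNormedType.Exports.

Local Open Scope classical_set_scope.
Local Open Scope ring_scope.

(** * Triangulated closed surfaces *)

(* The pair (f, i) stands both for the corner of the triangle f at its i-th
   vertex and for the side of f opposite to that vertex.

   If [tri_glue (f, i) = (f', p)], then the side i of f is glued to the side
   p i of f', the endpoint k <> i of the former being identified with the
   endpoint p k of the latter.  A triangle may be glued to itself along two of
   its sides, and no orientability is assumed.  Since every side is glued to
   exactly one other side, the quotient is automatically a closed surface; its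
   edges are the classes of sides and its vertices the classes of corners. *)
Section Combinatorics.
Variables (F : finType) (glue : F * 'I_3 -> F * {perm 'I_3}).

Definition glued_side (s : F * 'I_3) : F * 'I_3 :=
  ((glue s).1, (glue s).2 s.2).

Definition corner_adj : rel (F * 'I_3) :=
  [rel c c' | [exists i : 'I_3,
     (i != c.2) && (c' == ((glue (c.1, i)).1, (glue (c.1, i)).2 c.2))]].
End Combinatorics.

Record triangulated_surface := TriangulatedSurface {
  tri_V : finType;
  tri_E : finType;
  tri_F : finType;
  tri_glue : tri_F * 'I_3 -> tri_F * {perm 'I_3};
  tri_vert : tri_F * 'I_3 -> tri_V;
  tri_edge : tri_F * 'I_3 -> tri_E;
  tri_glueK : forall s,
    tri_glue (glued_side tri_glue s) = (s.1, ((tri_glue s).2^-1)%g);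
  tri_glue_neq : forall s, glued_side tri_glue s != s;
  tri_vert_eq : forall c c',
    tri_vert c = tri_vert c' <-> connect (corner_adj tri_glue) c c';
  tri_vert_surj : forall v, exists c, tri_vert c == v;
  tri_edge_eq : forall s s',
    tri_edge s = tri_edge s' <-> s' = s \/ s' = glued_side tri_glue s;
  tri_edge_surj : forall e, exists s, tri_edge s == e }.

(* Euler characteristic of the closed surface with the vertices removed. *)
Definition punctured_euler_char (T : triangulated_surface) : int :=
  (#|tri_V T|%:Z - #|tri_E T|%:Z + #|tri_F T|%:Z) - #|tri_V T|%:Z.

Definition side_of (T : triangulated_surface) (e : tri_E T) : tri_F T * 'I_3 :=
  xchoose (tri_edge_surj e).

(** * The hyperbolic plane: upper half-plane model *)

Section HyperbolicPlane.
Variable R : realType.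

(* The point x + iy, y > 0, is the pair (x, y). *)
Definition arcosh (t : R) : R := ln (t + Num.sqrt (t ^+ 2 - 1)).

Definition hdist (p q : R * R) : R :=
  arcosh (1 + ((p.1 - q.1) ^+ 2 + (p.2 - q.2) ^+ 2) / (2 * p.2 * q.2)).

Definition C1 (x : R -> R) : Prop :=
  (forall t, derivable x t 1) /\ continuous (derive1 x).

Definition hlength (x y : R -> R) : R :=
  Rintegral lebesgue_measure `[0, 1]
    (fun t => Num.sqrt (derive1 x t ^+ 2 + derive1 y t ^+ 2) / y t).

(* The column (a, b) <> 0 represents the ideal point a/b (infinity if b = 0)
   together with the horodisk { z | |a - b z|^2 <= Im z } centered there: the
   disk tangent to the real axis at a/b of Euclidean diameter 1/b^2, or the
   half-plane Im z >= a^2.  Proportional columns have the same ideal point,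
   opposite columns have the same horodisk, and every horodisk arises. *)
Definition same_ideal_point (u v : 'cV[R]_2) : Prop :=
  exists2 c : R, c != 0 & v = c *: u.

Definition det2 (u v : 'cV[R]_2) : R := u 0 0 * v 1 0 - u 1 0 * v 0 0.

Definition horodisk (u : 'cV[R]_2) : set (R * R) :=
  [set z | 0 < z.2 /\
     (u 0 0 - u 1 0 * z.1) ^+ 2 + (u 1 0 * z.2) ^+ 2 <= z.2].

Definition horocycle (u : 'cV[R]_2) : set (R * R) :=
  [set z | 0 < z.2 /\
     (u 0 0 - u 1 0 * z.1) ^+ 2 + (u 1 0 * z.2) ^+ 2 = z.2].

(* The geodesic joining the ideal points a/b and c/d is the half-circle (or
   vertical half-line) Re ((a - b z) (conj (c - d z))) = 0. *)
Definition ideal_geodesic (u v : 'cV[R]_2) : set (R * R) :=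
  [set z | 0 < z.2 /\
     (u 0 0 - u 1 0 * z.1) * (v 0 0 - v 1 0 * z.1)
       + u 1 0 * v 1 0 * z.2 ^+ 2 = 0].

(* The ideal points w and w' lie on different sides of the geodesic uv. *)
Definition separated (u v w w' : 'cV[R]_2) : Prop :=
  (det2 u w * det2 v w) * (det2 u w' * det2 v w') < 0.

(* A matrix g with det g = 1 (resp. -1) acts on the half-plane by the isometry
   z |-> (a z + b)/(c z + d) (resp. z |-> (a z' + b)/(c z' + d), z' = conj z).
   All isometries arise, two matrices give the same one iff they are equal up
   to sign, and the horodisk of u is sent to the horodisk of g *m u. *)
Definition is_isometry (g : 'M[R]_2) : Prop := \det g = 1 \/ \det g = -1.

Definition eq_upto_sign m n (A B : 'M[R]_(m, n)) : Prop := A = B \/ A = - B.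

Definition edge_point (u v : 'cV[R]_2) : R * R :=
  get (ideal_geodesic u v `&` horocycle u).

Definition generalized_edge_length (u v : 'cV[R]_2) : R :=
  let l := hdist (edge_point u v) (edge_point v u) in
  if `[< horodisk u `&` horodisk v = set0 >] then l else - l.

(* Hyperbolic length of the arc of the horocycle of u cut out by the edges
   from u to v and from u to w, computed along any C^1 path tracing it once. *)
Definition generalized_angle (u v w : 'cV[R]_2) : R :=
  get [set L | exists x y : R -> R,
    [/\ C1 x /\ C1 y,
        {in `[0, 1] &, injective (fun t => (x t, y t))},
        (forall t, t \in `[0, 1] -> horocycle u (x t, y t)),
        (x 0, y 0) = edge_point u v /\ (x 1, y 1) = edge_point u w
      & L = hlength x y]].
End HyperbolicPlane.

(** * Decorated Teichmueller space *)

Section Teichmueller.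
Variables (R : realType) (T : triangulated_surface).
Local Notation V := (tri_V T).
Local Notation E := (tri_E T).
Local Notation F := (tri_F T).
Local Notation glue := (@tri_glue T).

(* A hyperbolic metric on S, cut along the geodesic realization of the ideal
   triangulation: an ideal triangle of the hyperbolic plane for each f in F,
   and isometries gluing adjacent triangles along their edges. *)
Record hyperbolic_structure := HyperbolicStructure {
  hs_vert : F -> 'I_3 -> 'cV[R]_2;
  hs_glue : F -> 'I_3 -> 'M[R]_2;
  hs_vertP : forall f i j, i != j -> det2 (hs_vert f i) (hs_vert f j) != 0;
  hs_glue_isom : forall f i, is_isometry (hs_glue f i);
  hs_glueK : forall f i, let s := glued_side glue (f, i) in
    eq_upto_sign (hs_glue s.1 s.2 *m hs_glue f i) 1%:M;
  hs_glue_vert : forall f i k, k != i ->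
    same_ideal_point (hs_glue f i *m hs_vert f k)
                     (hs_vert (glue (f, i)).1 ((glue (f, i)).2 k));
  hs_glue_side : forall f i,
    separated (hs_glue f i *m hs_vert f (ordS i))
              (hs_glue f i *m hs_vert f (ord_pred i))
              (hs_glue f i *m hs_vert f i)
              (hs_vert (glue (f, i)).1 ((glue (f, i)).2 i)) }.

(* A choice of a horodisk at every ideal vertex of S: horodisks at the corners
   of the triangles that are matched by the gluing isometries. *)
Definition is_decoration (X : hyperbolic_structure)
    (B : F -> 'I_3 -> 'cV[R]_2) : Prop :=
  (forall f k, same_ideal_point (hs_vert X f k) (B f k)) /\
  (forall f i k, k != i ->
     eq_upto_sign (hs_glue X f i *m B f k)
                  (B (glue (f, i)).1 ((glue (f, i)).2 k))).

(* The glued metric is complete with cusp ends iff every puncture has a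
   neighbourhood obtained by gluing pieces of horodisks (otherwise the holonomy
   around some puncture is hyperbolic and preserves no horodisk). *)
Definition has_cusp_ends (X : hyperbolic_structure) : Prop :=
  exists B, is_decoration X B.

Definition cusped_metric := {X : hyperbolic_structure | has_cusp_ends X}.

HB.instance Definition _ := gen_eqMixin cusped_metric.
HB.instance Definition _ := gen_choiceMixin cusped_metric.

(* Isometries isotopic to the identity: after straightening, those which
   respect every triangle, together with the labels of its vertices. *)
Definition isometric (d d' : cusped_metric) : Prop :=
  exists m : F -> 'M[R]_2,
  [/\ forall f, is_isometry (m f),
      forall f k, same_ideal_point (m f *m hs_vert (sval d) f k)
                                   (hs_vert (sval d') f k)
    & forall f i, eq_upto_sign (hs_glue (sval d') f i *m m f)
                    (m (glue (f, i)).1 *m hs_glue (sval d) f i)].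

Lemma isometric_refl d : isometric d d.
Proof.
exists (fun=> 1%:M); split=> [f|f k|f i].
- by left; rewrite det1.
- by exists 1; rewrite ?oner_neq0// mul1mx scale1r.
- by left; rewrite mulmx1 mul1mx.
Qed.

Lemma isometry_unit (g : 'M[R]_2) : is_isometry g -> g \in unitmx.
Proof. by case=> dg; rewrite unitmxE dg ?unitrN unitr1. Qed.

Lemma isometric_sym d d' : isometric d d' -> isometric d' d.
Proof.
case=> m [mI mV mG]; have mU f := isometry_unit (mI f).
exists (fun f => invmx (m f)); split=> [f|f k|f i].
- by rewrite /is_isometry det_inv; case: (mI f) => ->;
    [left; rewrite invr1 | right; rewrite invrN invr1].
- have [c c0 ->] := mV f k; exists c^-1; first by rewrite invr_eq0.
  by rewrite -scalemxAr mulKmx// scalerA mulVf// scale1r.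
- set f' := (glue (f, i)).1; have [eG|eG] := mG f i; [left|right].
    by rewrite -[LHS](mulKmx (mU f')) [m f' *m _]mulmxA -eG mulmxK.
  rewrite -[LHS](mulKmx (mU f')) [m f' *m _]mulmxA.
  by rewrite -[m f' *m _]opprK -eG mulNmx mulmxK// mulmxN.
Qed.

Lemma isometric_trans d d' d'' :
  isometric d d' -> isometric d' d'' -> isometric d d''.
Proof.
case=> m [mI mV mG] [n [nI nV nG]].
exists (fun f => n f *m m f); split=> [f|f k|f i].
- rewrite /is_isometry det_mulmx.
  by case: (mI f) => ->; case: (nI f) => ->;
    rewrite ?mulr1 ?mul1r ?mulrNN ?mulr1; [left|right|right|left].
- have [c c0 e] := mV f k; have [c' c'0 ->] := nV f k.
  exists (c' * c); first by rewrite mulf_neq0.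
  by rewrite e -scalemxAr scalerA mulmxA.
- have [e|e] := mG f i; have [e'|e'] := nG f i; [left|right|right|left];
  by rewrite mulmxA e' ?mulNmx -!mulmxA e ?mulmxN ?opprK.
Qed.

Definition isometricb : rel cusped_metric := fun d d' => `[< isometric d d' >].

Lemma isometricb_equiv : equiv_class_of isometricb.
Proof.
split.
- by move=> d; apply/asboolP/isometric_refl.
- by move=> d d'; apply/asboolP/asboolP; exact: isometric_sym.
- by move=> d d' d'' /asboolP h /asboolP h'; apply/asboolP;
    exact: isometric_trans h h'.
Qed.

Canonical isometric_equiv := EquivRelPack isometricb_equiv.

Definition teichmueller_space : Type := {eq_quot isometric_equiv}%qT.

Definition decorated_teichmueller_space : Type :=
  (teichmueller_space * (V -> {posnum R}))%type.

Definition corner_angle (B : F -> 'I_3 -> 'cV[R]_2) (f : F) (k : 'I_3) : R :=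
  generalized_angle (B f k) (B f (ordS k)) (B f (ord_pred k)).

Definition horocycle_length (B : F -> 'I_3 -> 'cV[R]_2) (v : V) : R :=
  \sum_(c : F * 'I_3 | tri_vert c == v) corner_angle B c.1 c.2.

Definition rep (d : teichmueller_space) : cusped_metric := repr d.

(* The horodisks of (d, r); they exist and are unique (as columns, up to
   sign). *)
Definition horodisks (dr : decorated_teichmueller_space) :
    F -> 'I_3 -> 'cV[R]_2 :=
  xget (fun _ _ => 0)
    [set B | is_decoration (sval (rep dr.1)) B /\
             forall v, horocycle_length B v = (dr.2 v)%:num].

(* R^E is the space of row vectors indexed by the enumeration of E. *)
Definition length_map (dr : decorated_teichmueller_space) : 'rV[R]_#|E| :=
  \row_j let: (f, i) := side_of (enum_val j) in
    generalized_edge_length (horodisks dr f (ordS i))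
                            (horodisks dr f (ord_pred i)).

Definition oriented_integral (a b : R) (g : R -> R) : R :=
  if a <= b then Rintegral lebesgue_measure `[a, b] g
  else - Rintegral lebesgue_measure `[b, a] g.

(* The sum has two terms: one for each of the two sides glued along e. *)
Definition Psi (h : R) (dr : decorated_teichmueller_space) : 'rV[R]_#|E| :=
  \row_j \sum_(s : F * 'I_3 | tri_edge s == enum_val j)
    let theta := corner_angle (horodisks dr) s.1 in
    oriented_integral 0
      ((theta (ordS s.2) + theta (ord_pred s.2) - theta s.2) / 2)
      (fun t => expR (h * t ^+ 2)).
End Teichmueller.

(** * Smooth embeddings *)

Section Smooth.
Variable R : realType.

Fixpoint Ck (k : nat) (U W : normedModType R) (f : U -> W) : Prop :=
  if k is k'.+1 then
    (forall x, differentiable f x) /\ (forall v, Ck k' (fun x => 'd f x v))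
  else continuous f.

Definition smooth (U W : normedModType R) (f : U -> W) : Prop :=
  forall k, Ck k f.

Definition immersion (U W : normedModType R) (f : U -> W) : Prop :=
  forall x, injective ('d f x).

Definition topological_embedding (U W : topologicalType) (f : U -> W) : Prop :=
  [/\ injective f, continuous f &
      forall A, open A -> exists2 B, open B & f @` A = B `&` range f].

Definition smooth_embedding (U W : normedModType R) (f : U -> W) : Prop :=
  [/\ smooth f, immersion f & topological_embedding f].

(* Smooth embedding of the manifold X whose smooth structure (in particular
   its topology) is the one making the bijection phi : X -> U a
   diffeomorphism. *)
Definition smooth_embedding_in_chart (X : Type) (U W : normedModType R)
    (phi : X -> U) (f : X -> W) : Prop :=
  exists psi : U -> X,
    [/\ cancel phi psi, cancel psi phi & smooth_embedding (f \o psi)].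
End Smooth.

(* Main.v *)
Require Import Defs.
From HB Require Import structures.
From mathcomp Require Import all_boot all_order all_algebra all_fingroup.
From mathcomp Require Import generic_quotient.
From mathcomp Require Import all_classical all_reals all_analysis.
From mathcomp Require Import ring lra.

(** The proof has a geometric half and an analytic half.

    Geometry.  Columns [u], [v], [w] represent horodisks, and every quantity of
    a decorated ideal triangle is a function of determinants: the generalized
    length of the edge uv is 2 ln |det(u, v)| ([generalized_edge_lengthE]) and
    the generalized angle at u is |det(v, w)| / (|det(u, v)| |det(u, w)|)
    ([generalized_angleE]).  Three horodisks are determined by the absolute
    values of their determinants up to an isometry, any three positive values
    occur, and there is exactly one way to glue two decorated triangles along
    edges of the same length so that they lie on different sides.  Hence the
    length map is a bijection onto R^E ([length_map_inj], [length_map_surj]), and the composition of Psi with its inverse is an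
    explicit map Phi of the edge lengths ([PsiE]).

    Analysis.  In a triangle with edge lengths l_i and angles a_i, put
    x_i = (a_j + a_k - a_i) / 2.  Two identities hold:
    - the quadratic form of the matrix (d x_i / d l_j) at w is minus the sum over
      k of a_k / 4 (w_i + w_j - w_k)^2, so it is negative definite
      ([sum_dexcess]);
    - x_i^2 - exp(- l_i) does not depend on i ([weight_excess]).
    By the second one, the weights exp(h x_i^2) that the integrand brings into
    the Jacobian of Phi become the same for the three edges of a triangle after
    multiplication by exp(- h exp(- l_i)), a function of l_i alone.  So for
    the coordinates u with du = exp(- h exp(- l)) dl on each edge, the
    directional derivative of Phi paired with the direction in u is negative
    ([dPhi_negative]).  This makes Phi an immersion.  The lengths fill a product
    of open intervals in the coordinates u, hence an open convex set, and
    the mean value theorem on straight segments shows that Phi is strictly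
    monotone (decreasing) in u ([Phi_monotone]).  A strictly monotone continuous
    map on an open convex subset of R^n is injective with a continuous inverse
    ([Phi_inverse_continuous]), so Phi is an embedding. *)

Set Implicit Arguments.
Unset Strict Implicit.
Unset Printing Implicit Defensive.
Import Order.TTheory GRing.Theory Num.Theory.
Import numFieldNormedType.Exports.
Local Open Scope classical_set_scope.
Local Open Scope ring_scope.

(** * Horocycles, geodesics and edge lengths *)

Section Horocycles.
Variable R : realType.
Implicit Types (u v w : 'cV[R]_2) (z : R * R) (s : R).

(** Polarization of the quadratic form in the equation of a horocycle.  With it,
    the horocycle of u is [pairing u u z = Im z], the horodisk is
    [pairing u u z <= Im z] and the geodesic uv is [pairing u v z = 0]. *)
Definition pairing u v z : R :=
  (u 0 0 - u 1 0 * z.1) * (v 0 0 - v 1 0 * z.1) + u 1 0 * v 1 0 * z.2 ^+ 2.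

Lemma pairing_gram u v z :
  pairing u u z * pairing v v z - pairing u v z ^+ 2 = (det2 u v * z.2) ^+ 2.
Proof. by rewrite /pairing /det2; ring. Qed.

Lemma det2C u v : det2 v u = - det2 u v.
Proof. by rewrite /det2; ring. Qed.

Lemma horocycleE u z : horocycle u z <-> 0 < z.2 /\ pairing u u z = z.2.
Proof.
have -> : pairing u u z =
    (u 0 0 - u 1 0 * z.1) ^+ 2 + (u 1 0 * z.2) ^+ 2 by rewrite /pairing; ring.
by [].
Qed.

Lemma horodiskE u z : horodisk u z <-> 0 < z.2 /\ pairing u u z <= z.2.
Proof.
have -> : pairing u u z =
    (u 0 0 - u 1 0 * z.1) ^+ 2 + (u 1 0 * z.2) ^+ 2 by rewrite /pairing; ring.
by [].
Qed.

Definition horopoint_den u v s : R :=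
  (det2 u v * u 1 0 * s + v 1 0) ^+ 2 + (det2 u v * u 1 0) ^+ 2.

(** The image of s + i, a point of the horocycle Im z = 1 centered at infinity,
    under an isometry that sends infinity to the ideal point of u and 0 to that
    of v.  The line Re z = 0 goes to the geodesic uv, so s = 0 is the point
    where that edge starts; and s is the signed arc length from there. *)
Definition horopoint u v s : R * R :=
  (((det2 u v * u 0 0 * s + v 0 0) * (det2 u v * u 1 0 * s + v 1 0)
      + det2 u v ^+ 2 * u 0 0 * u 1 0) / horopoint_den u v s,
   det2 u v ^+ 2 / horopoint_den u v s).

Lemma horopoint_den_gt0 u v s : det2 u v != 0 -> 0 < horopoint_den u v s.
Proof.
move=> D0; rewrite lt0r; apply/andP; split; last by rewrite addr_ge0 ?sqr_ge0.
rewrite paddr_eq0 ?sqr_ge0// !sqrf_eq0; apply/negP => /andP[].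
rewrite mulf_eq0 (negPf D0)/= => + /eqP u1.
rewrite u1 mulr0 mul0r add0r => /eqP v1.
by move: D0; rewrite /det2 u1 v1 mulr0 mul0r subrr eqxx.
Qed.

Lemma horopointP u v s : det2 u v != 0 ->
  horocycle u (horopoint u v s).
Proof.
move=> D0; have N0 := horopoint_den_gt0 s D0.
apply/horocycleE; rewrite /= divr_gt0 ?exprn_even_gt0//; split => //.
have N1 := lt0r_neq0 N0; move: N1; rewrite /pairing/= /horopoint_den /det2 => N1.
by field.
Qed.

Lemma pairing_horopoint u v s : det2 u v != 0 ->
  pairing u v (horopoint u v s) = - (det2 u v * s * (horopoint u v s).2).
Proof.
move=> D0; have N1 := lt0r_neq0 (horopoint_den_gt0 s D0).
by move: N1; rewrite /pairing/= /horopoint_den /det2 => N1; field.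
Qed.

(** The inverse of [horopoint u v] on the horocycle of u. *)
Definition arc_coord u v z : R := - (pairing u v z / (det2 u v * z.2)).

Lemma horopointK u v : det2 u v != 0 ->
  cancel (horopoint u v) (arc_coord u v).
Proof.
move=> D0 s; rewrite /arc_coord pairing_horopoint//.
have /horocycleE[/lt0r_neq0 y0 _] := horopointP s D0.
by field; rewrite y0.
Qed.

(** Put p = u_0 - u_1 x and D = det(u, v).  By the equation
    p^2 + (u_1 y)^2 = y of the horocycle, the two linear factors in [horopoint]
    at the arc coordinate of z are p D / y and D (p x - u_1 y^2) / y, and the
    denominator is D^2 / y. *)
Lemma arc_coordK u v z : det2 u v != 0 -> horocycle u z ->
  horopoint u v (arc_coord u v z) = z.
Proof.
move=> D0 /horocycleE; case: z => x y /= [y0 hz].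
have y1 := lt0r_neq0 y0.
set p := u 0 0 - u 1 0 * x.
have hy : p ^+ 2 + u 1 0 ^+ 2 * y ^+ 2 = y.
  by rewrite -[RHS]hz /pairing /p /=; ring.
have e1 : det2 u v * u 1 0 * arc_coord u v (x, y) + v 1 0 = p * det2 u v / y.
  transitivity ((v 1 0 * (p ^+ 2 + u 1 0 ^+ 2 * y ^+ 2)
      - u 1 0 * pairing u v (x, y)) / y).
    by rewrite hy /arc_coord /=; field; rewrite y1.
  by rewrite /pairing /= /p /det2; field.
have e0 : det2 u v * u 0 0 * arc_coord u v (x, y) + v 0 0
    = det2 u v * (p * x - u 1 0 * y ^+ 2) / y.
  transitivity ((v 0 0 * (p ^+ 2 + u 1 0 ^+ 2 * y ^+ 2)
      - u 0 0 * pairing u v (x, y)) / y).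
    by rewrite hy /arc_coord /=; field; rewrite y1.
  by rewrite /pairing /= /p /det2; field.
have eN : horopoint_den u v (arc_coord u v (x, y)) = det2 u v ^+ 2 / y.
  rewrite /horopoint_den e1.
  transitivity (det2 u v ^+ 2 * (p ^+ 2 + u 1 0 ^+ 2 * y ^+ 2) / y ^+ 2).
    by field.
  by rewrite hy; field.
rewrite /horopoint eN e1 e0; congr pair; last by field; rewrite y1 D0.
transitivity (x * (p ^+ 2 + u 1 0 ^+ 2 * y ^+ 2) / y); last by rewrite hy mulfK.
by rewrite /p; field; rewrite y1 D0.
Qed.

Lemma edge_pointE u v : det2 u v != 0 -> edge_point u v = horopoint u v 0.
Proof.
move=> D0; have hz := horopointP 0 D0; have /horocycleE[y0 _] := hz.
apply: get_subset1.
  split=> //; split=> //; rewrite -[LHS]/(pairing u v _) pairing_horopoint//.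
  by rewrite mulr0 mul0r oppr0.
suff E z : (ideal_geodesic u v `&` horocycle u) z -> z = horopoint u v 0.
  by move=> z z' /E-> /E->.
case=> -[_ gz] cz; rewrite -(arc_coordK D0 cz); congr horopoint.
by rewrite /arc_coord [pairing u v z]gz mul0r oppr0.
Qed.

(** The arc from the edge uv to the edge uw has this signed length; everything
    about generalized angles follows from this value. *)
Lemma arc_coord_edge_point u v w : det2 u v != 0 -> det2 u w != 0 ->
  arc_coord u v (edge_point u w) = det2 w v / (det2 u v * det2 u w).
Proof.
move=> D0 D1; rewrite (edge_pointE D1).
have /horocycleE[y0 cz] := horopointP 0 D1.
have pz := pairing_horopoint 0 D1; rewrite mulr0 mul0r oppr0 in pz.
move: (horopoint u w 0) y0 cz pz => z y0 cz pz.
have yn := lt0r_neq0 y0.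
(* w is a combination of u and v, and the pairing is bilinear *)
have : det2 u v * pairing u w z
    = det2 w v * pairing u u z + det2 u w * pairing u v z.
  by rewrite /pairing /det2; ring.
rewrite pz cz mulr0 => /eqP; rewrite eq_sym addrC addr_eq0 => /eqP e.
rewrite /arc_coord; apply: (mulfI D1).
rewrite mulrN mulrA e; field.
by rewrite yn D0 D1.
Qed.

(** The argument of arcosh is (D^2 + D^-2) / 2 = cosh (2 ln |D|) where D is the
    determinant. *)
Lemma hdist_edge_point u v : det2 u v != 0 ->
  hdist (edge_point u v) (edge_point v u) = `|2 * ln `|det2 u v| |.
Proof.
move=> D0; have D0' : det2 v u != 0 by rewrite det2C oppr_eq0.
rewrite !edge_pointE// /hdist.
set D := det2 u v.
have -> : 1 + (((horopoint u v 0).1 - (horopoint v u 0).1) ^+ 2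
      + ((horopoint u v 0).2 - (horopoint v u 0).2) ^+ 2)
      / (2 * (horopoint u v 0).2 * (horopoint v u 0).2)
    = (D ^+ 2 + D ^- 2) / 2.
  have := lt0r_neq0 (horopoint_den_gt0 0 D0).
  have := lt0r_neq0 (horopoint_den_gt0 0 D0').
  rewrite /horopoint /= /horopoint_den [det2 v u]det2C -/D !mulr0 !add0r.
  rewrite !mulNr !sqrrN => N1 N0.
  move: D0; rewrite -/D => D0.
  suff e : ((v 0 0 * v 1 0 + D ^+ 2 * u 0 0 * u 1 0)
               * (u 1 0 ^+ 2 + (D * v 1 0) ^+ 2)
            - (u 0 0 * u 1 0 + D ^+ 2 * v 0 0 * v 1 0)
               * (v 1 0 ^+ 2 + (D * u 1 0) ^+ 2))
           = (D ^+ 4 - 1) * u 1 0 * v 1 0 * D.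
    have -> : (v 0 0 * v 1 0 + D ^+ 2 * u 0 0 * u 1 0)
          / (v 1 0 ^+ 2 + (D * u 1 0) ^+ 2)
        - (u 0 0 * u 1 0 + D ^+ 2 * v 0 0 * v 1 0)
          / (u 1 0 ^+ 2 + (D * v 1 0) ^+ 2)
        = (D ^+ 4 - 1) * u 1 0 * v 1 0 * D
          / ((u 1 0 ^+ 2 + (D * v 1 0) ^+ 2) * (v 1 0 ^+ 2 + (D * u 1 0) ^+ 2)).
      by rewrite -e; field; rewrite N0 N1.
    by field; rewrite N0 N1 D0.
  by rewrite /D /det2; ring.
have D2 : 0 < D ^+ 2 by rewrite exprn_even_gt0.

rewrite mulr_natl -lnXn ?normr_gt0// real_normK ?num_real//.
move: (D ^+ 2) D2 => E E0; rewrite /arcosh.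
have -> : ((E + E^-1) / 2) ^+ 2 - 1 = ((E - E^-1) / 2) ^+ 2.
  by field; rewrite lt0r_neq0.
rewrite sqrtr_sqr; have [E1|/ltW E1] := leP 1 E.
  have EV : E^-1 <= 1 by rewrite invf_le1.
  rewrite !ger0_norm ?ln_ge0//; last by lra.
  by congr ln; field; rewrite lt0r_neq0.
have EV : 1 <= E^-1 by rewrite invf_ge1.
rewrite !ler0_norm ?ln_le0//; last by lra.
by rewrite -lnV//; congr ln; field; rewrite lt0r_neq0.
Qed.

(** If z is in both horodisks, the Gram identity [pairing_gram] forces
    D^2 y^2 <= y^2.  If |D| <= 1, the same identity at the point where the edge
    meets the first horocycle, where the mixed term vanishes, puts that point
    in the second horodisk. *)
Lemma horodisk_disjoint u v : det2 u v != 0 ->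
  (horodisk u `&` horodisk v = set0) <-> 1 < `|det2 u v|.
Proof.
move=> D0; split=> [h|h].
  rewrite ltNge; apply/negP => D1.
  have /horocycleE[y0 hz] := horopointP 0 D0.
  have pz := pairing_horopoint 0 D0; rewrite mulr0 mul0r oppr0 in pz.
  have := pairing_gram u v (horopoint u v 0).
  have : (horodisk u `&` horodisk v) (horopoint u v 0) -> False by rewrite h.
  move: (horopoint u v 0) y0 hz pz => z y0 hz pz nz.
  rewrite pz hz expr0n/= subr0 exprMn => e; apply: nz.
  have {}e : pairing v v z = det2 u v ^+ 2 * z.2.
    by apply: (mulfI (lt0r_neq0 y0)); rewrite e; ring.
  split; apply/horodiskE; split=> //; first by rewrite hz.
  rewrite e ger_pMl// -real_normK ?num_real//.
  by rewrite expr_le1.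
rewrite -subset0 => z [/horodiskE[y0 hu] /horodiskE[_ hv]].
have g := pairing_gram u v z.
have pos w : 0 <= pairing w w z.
  have -> : pairing w w z =
    (w 0 0 - w 1 0 * z.1) ^+ 2 + (w 1 0 * z.2) ^+ 2 by rewrite /pairing; ring.
  by rewrite addr_ge0 ?sqr_ge0.
have : (det2 u v * z.2) ^+ 2 <= z.2 ^+ 2.
  rewrite -g expr2 [z.2 ^+ 2]expr2; apply: (@le_trans _ _ (pairing u u z * pairing v v z)).
    by rewrite gerBl -expr2 sqr_ge0.
  exact: ler_pM.
rewrite exprMn ger_pMl ?exprn_even_gt0 ?lt0r_neq0//.
by apply/negP; rewrite -ltNge -real_normK ?num_real// expr_gt1.
Qed.

(** The sign convention for overlapping horodisks is the sign of the logarithm. *)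
Lemma generalized_edge_lengthE u v : det2 u v != 0 ->
  generalized_edge_length u v = 2 * ln `|det2 u v|.
Proof.
move=> D0; rewrite /generalized_edge_length hdist_edge_point//.
case: asboolP => [/(horodisk_disjoint D0) h|h].
  by rewrite ger0_norm// mulr_ge0// ln_ge0// ltW.
have {}h : `|det2 u v| <= 1.
  by rewrite leNgt; apply/negP => /(horodisk_disjoint D0).
by rewrite ler0_norm ?opprK// mulr_ge0_le0// ln_le0.
Qed.
End Horocycles.

(** * Length of horocyclic arcs *)

Section ArcLength.
Variable R : realType.
Implicit Types (u v w : 'cV[R]_2).

(** An injective continuous function on a segment is monotone, so its derivative
    has a constant sign and the integral of its absolute value telescopes. *)
Lemma Rintegral_norm_derive1 (sigma speed : R -> R) :
  (forall t : R, t \in `[0, 1] -> derivable sigma t 1) ->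
  {in `[0, 1] &, injective sigma} ->
  {within `[0, 1], continuous speed} ->
  (forall t : R, t \in `]0, 1[ -> speed t = `|derive1 sigma t|) ->
  Rintegral lebesgue_measure `[0, 1] speed = `|sigma 1 - sigma 0|.
Proof.
move=> ds inj cs es.
have oc (t : R) : t \in `]0, 1[ -> t \in `[0, 1] :> bool.
  by rewrite !in_itv/= => /andP[/ltW-> /ltW->].
have ct (t : R) : t \in `[0, 1] -> {for t, continuous sigma}.
  by move=> /ds /derivable1_diffP /differentiable_continuous.
have cw : {within `[0, 1], continuous sigma}.
  by apply: continuous_in_subspaceT => t /[!inE] tI; apply: ct; rewrite inE in tI *.
have FTC (F : R -> R) : (forall t : R, t \in `[0, 1] -> derivable F t 1) ->
    (forall t : R, t \in `]0, 1[ -> derive1 F t = speed t) ->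
    Rintegral lebesgue_measure `[0, 1] speed = F 1 - F 0.
  move=> dF eF; rewrite /Rintegral (@continuous_FTC2 _ _ F) ?ltr01//.
  have cF (t : R) : t \in `[0, 1] -> {for t, continuous F}.
    by move=> /dF /derivable1_diffP /differentiable_continuous.
  split=> [t /oc /dF //| |].
  - by apply: cvg_at_right_filter; apply: cF; rewrite in_itv/= lexx ler01.
  - by apply: cvg_at_left_filter; apply: cF; rewrite in_itv/= lexx ler01.
have I0 : (0 : R) \in `[0, 1] by rewrite in_itv/= lexx ler01.
have I1 : (1 : R) \in `[0, 1] by rewrite in_itv/= lexx ler01.
have [mono|mono] := itv_continuous_inj_mono cw inj.
  rewrite (FTC sigma)// => [|t tI].
    by rewrite ger0_norm// subr_ge0 ltW// mono// ltr01.
  rewrite es// ger0_norm//.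
  apply: (@incr_derive1_ge0_itv _ _ true false 0 1) => // s; rewrite inE.
  by move=> /oc/ds.
rewrite (FTC (- sigma)) => [|t tI|t tI].
- rewrite ler0_norm; first by rewrite !fctE; ring.
  by rewrite subr_le0 ltW// mono// ltr01.
- by apply: derivableN; exact: ds.
- rewrite es// derive1E deriveN; last exact/ds/oc.
  rewrite -derive1E ler0_norm//.
  apply: (@decr_derive1_le0_itv _ _ true false 0 1) => //.
    by move=> s /[!inE] /oc/ds.
Qed.

Definition horopoint_deriv1 u v (s : R) : R :=
  det2 u v ^+ 2 * ((det2 u v * u 1 0 * s + v 1 0) ^+ 2
                   - (det2 u v * u 1 0) ^+ 2) / horopoint_den u v s ^+ 2.

Definition horopoint_deriv2 u v (s : R) : R :=
  - (2 * det2 u v ^+ 2 * (det2 u v * u 1 0 * s + v 1 0) * (det2 u v * u 1 0))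
    / horopoint_den u v s ^+ 2.

(** Writing the point as (r p + t q) / N, D^2 / N with N = p^2 + q^2, both
    derivatives have the numerator t p - q r = D^2 as a factor. *)
Lemma is_derive_horopoint u v (s : R) : det2 u v != 0 ->
  is_derive s 1 (fun s => (horopoint u v s).1) (horopoint_deriv1 u v s) /\
  is_derive s 1 (fun s => (horopoint u v s).2) (horopoint_deriv2 u v s).
Proof.
move=> D0; have N0 := lt0r_neq0 (horopoint_den_gt0 s D0).
pose q := det2 u v * u 1 0; pose t := det2 u v * u 0 0.
pose p (s : R) := q * s + v 1 0; pose r (s : R) := t * s + v 0 0.
have dp : is_derive s 1 p q.
  by apply: is_derive_eq; rewrite /GRing.scale /=; ring.
have dr : is_derive s 1 r t.
  by apply: is_derive_eq; rewrite /GRing.scale /=; ring.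
have dN : is_derive s 1 (fun s => p s ^+ 2 + q ^+ 2) (2 * q * p s).
  by apply: is_derive_eq; rewrite /GRing.scale /=; ring.
have dV : is_derive s 1 (fun s => (p s ^+ 2 + q ^+ 2)^-1)
    (- (p s ^+ 2 + q ^+ 2) ^- 2 *: (2 * q * p s)) := is_deriveV N0 dN.
have dn : is_derive s 1 (fun s => r s * p s + t * q) (r s * q + t * p s).
  by apply: is_derive_eq; rewrite /GRing.scale /=; ring.
have eD : det2 u v ^+ 2 = t * p s - q * r s.
  by rewrite /p /r /q /t /det2; ring.
set N := p s ^+ 2 + q ^+ 2; have {}N0 : N != 0 by [].
rewrite /horopoint_deriv1 /horopoint_deriv2.
have -> : horopoint_den u v s = N by [].
rewrite -/q -[q * s + v 1 0]/(p s); split.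
- rewrite (_ : (fun _ => _) =
      (fun s => r s * p s + t * q) * (fun s => (p s ^+ 2 + q ^+ 2)^-1)).
    apply: is_derive_eq; rewrite /GRing.scale /= -/N eD.
    by move: N0; rewrite /N; move: (p s) (r s) => p1 r1 N0; field.
  apply/funext => s'; rewrite /horopoint/= fctE; congr (_ / _).
  by rewrite /p /r /q /t; ring.
- rewrite (_ : (fun _ => _) =
      (fun=> det2 u v ^+ 2) * (fun s => (p s ^+ 2 + q ^+ 2)^-1))//.
  apply: is_derive_eq; rewrite /GRing.scale /= -/N.
  by move: N0; rewrite /N; move: (p s) => p1 N0; field.
Qed.

(** [horopoint] runs along the horocycle at unit hyperbolic speed. *)
Lemma horopoint_speed u v (s : R) : det2 u v != 0 ->
  horopoint_deriv1 u v s ^+ 2 + horopoint_deriv2 u v s ^+ 2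
    = (horopoint u v s).2 ^+ 2.
Proof.
move=> D0; have := lt0r_neq0 (horopoint_den_gt0 s D0).
rewrite /horopoint_deriv1 /horopoint_deriv2 /horopoint /= /horopoint_den.
move: (det2 u v) => D N0; field.
by rewrite N0.
Qed.

Lemma cvg_sqr (f : R -> R) (s l : R) :
  f t @[t --> s] --> l -> f t ^+ 2 @[t --> s] --> l ^+ 2.
Proof.
move=> cf; rewrite expr2 (_ : (fun t => f t ^+ 2) = fun t => f t * f t).
  by apply: cvgM.
by apply/funext => t; rewrite expr2.
Qed.

Lemma continuous_horopoint_deriv u v : det2 u v != 0 ->
  continuous (horopoint_deriv1 u v) /\ continuous (horopoint_deriv2 u v).
Proof.
move=> D0.
have cp : continuous (fun s : R => det2 u v * u 1 0 * s + v 1 0).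
  by move=> s; apply: cvgD; [apply: cvgM; [exact: cvg_cst|exact: cvg_id]|exact: cvg_cst].
have cp2 : continuous (fun s : R => (det2 u v * u 1 0 * s + v 1 0) ^+ 2).
  by move=> s; apply: cvg_sqr; exact: cp.
have cV : continuous (fun s : R => (horopoint_den u v s ^+ 2)^-1).
  move=> s; apply: cvgV; first by rewrite sqrf_eq0 lt0r_neq0// horopoint_den_gt0.
  apply: cvg_sqr.
  by apply: cvgD; [exact: cp2|exact: cvg_cst].
split=> s.
  apply: cvgM; last exact: cV.
  by apply: cvgM; [exact: cvg_cst|apply: cvgB; [exact: cp2|exact: cvg_cst]].
apply: cvgM; last exact: cV.
apply: cvgN; apply: cvgM; last exact: cvg_cst.
by apply: cvgM; [exact: cvg_cst|exact: cp].
Qed.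

(** On a horocycle the hyperbolic length element is |d sigma| for the arc
    coordinate sigma, and sigma is injective along the path because a point of
    the horocycle is determined by it. *)
Lemma hlength_horocycle u v (x y : R -> R) : det2 u v != 0 -> C1 x -> C1 y ->
  {in `[0, 1] &, injective (fun t => (x t, y t))} ->
  (forall t, t \in `[0, 1] -> horocycle u (x t, y t)) ->
  hlength x y = `|arc_coord u v (x 1, y 1) - arc_coord u v (x 0, y 0)|.
Proof.
move=> D0 [dx cx'] [dy cy'] inj hor; rewrite /hlength.
have y0 (t : R) : t \in `[0, 1] -> y t != 0.
  by move=> tI; have /horocycleE[/lt0r_neq0] := hor _ tI.
have oc (t : R) : t \in `]0, 1[ -> t \in `[0, 1] :> bool.
  by rewrite !in_itv/= => /andP[/ltW-> /ltW->].
have cx t : {for t, continuous x}.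
  by have /derivable1_diffP /differentiable_continuous := dx t.
have cy t : {for t, continuous y}.
  by have /derivable1_diffP /differentiable_continuous := dy t.
have ds (t : R) : t \in `[0, 1] ->
    derivable (fun t => arc_coord u v (x t, y t)) t 1.
  move=> tI; have dxt := derivableP (dx t); have dyt := derivableP (dy t).
  rewrite /arc_coord /pairing /=.
  apply: derivableN; apply: derivableM; last first.
    apply: derivableV; first by rewrite mulf_neq0 ?y0.
    by apply: derivableM.
  by [].
pose sigma t := arc_coord u v (x t, y t).
rewrite (Rintegral_norm_derive1 (sigma := sigma))//.
- move=> s t sI tI /(congr1 (horopoint u v)).
  have hs := hor _ sI; have ht := hor _ tI.
  by rewrite !arc_coordK// => /inj; apply.
- apply: continuous_in_subspaceT => t; rewrite inE => tI.
  apply: cvgM; last by apply: cvgV; [exact: y0|exact: cy].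
  apply: continuous_comp; last exact: sqrt_continuous.
  by apply: cvgD; apply: cvg_sqr; [exact: cx'|exact: cy'].
move=> t tI; have tI' := oc _ tI.
have [dX dY] := is_derive_horopoint (sigma t) D0.
have dst : is_derive t 1 sigma (derive1 sigma t).
  by rewrite derive1E; apply: derivableP; exact: ds.
(* so that the derivatives of x and y can be computed through sigma *)
have nearI : \forall s \near t, horopoint u v (sigma s) = (x s, y s).
  near=> s; apply: arc_coordK => //; apply: hor; apply: oc.
  by near: s; exact: near_in_itvoo.
have ex : derive1 x t = horopoint_deriv1 u v (sigma t) * derive1 sigma t.
  have nearx : \forall s \near t,
      ((fun s => (horopoint u v s).1) \o sigma) s = x s.
    by apply: filterS nearI => s e; rewrite [LHS]/comp e.
  by have [_ <-] := near_eq_is_derive nearx (is_derive1_comp dX dst);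
    rewrite derive1E.
have ey : derive1 y t = horopoint_deriv2 u v (sigma t) * derive1 sigma t.
  have neary : \forall s \near t,
      ((fun s => (horopoint u v s).2) \o sigma) s = y s.
    by apply: filterS nearI => s e; rewrite [LHS]/comp e.
  by have [_ <-] := near_eq_is_derive neary (is_derive1_comp dY dst);
    rewrite derive1E.
rewrite ex ey (exprMn 2 (horopoint_deriv1 _ _ _)).
rewrite (exprMn 2 (horopoint_deriv2 _ _ _)) -mulrDl horopoint_speed//.
have ht := hor _ tI'; rewrite arc_coordK//=.
rewrite -exprMn sqrtr_sqr normrM.
have /horocycleE[/= yt _] := hor _ tI'.
by rewrite gtr0_norm// mulrAC divff ?mul1r ?lt0r_neq0.
Unshelve. all: by end_near. Qed.

(** All admissible paths have the length computed by [hlength_horocycle], and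
    [horopoint] run at constant speed is one of them. *)
Lemma generalized_angleE u v w :
  det2 u v != 0 -> det2 u w != 0 -> det2 v w != 0 ->
  generalized_angle u v w = `|det2 v w| / (`|det2 u v| * `|det2 u w|).
Proof.
move=> Duv Duw Dvw; pose s1 := arc_coord u v (edge_point u w).
have s1E : s1 = det2 w v / (det2 u v * det2 u w) by apply: arc_coord_edge_point.
have s10 : s1 != 0.
  by rewrite s1E mulf_neq0 ?invr_eq0 ?mulf_neq0// det2C oppr_eq0.
have -> : `|det2 v w| / (`|det2 u v| * `|det2 u w|) = `|s1|.
  by rewrite s1E normrM normfV normrM det2C normrN.
have hw : horocycle u (edge_point u w).
  by rewrite edge_pointE//; exact: horopointP.
have len x y : [/\ C1 x /\ C1 y,
        {in `[0, 1] &, injective (fun t => (x t, y t))},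
        (forall t, t \in `[0, 1] -> horocycle u (x t, y t))
      & (x 0, y 0) = edge_point u v /\ (x 1, y 1) = edge_point u w] ->
    hlength x y = `|s1|.
  case=> -[cx cy] inj hor [e0 e1].
  rewrite (hlength_horocycle Duv)// e0 e1 (edge_pointE Duv) horopointK//.
  by rewrite subr0.
have [cX cY] := continuous_horopoint_deriv Duv.
pose x t := (horopoint u v (s1 * t)).1; pose y t := (horopoint u v (s1 * t)).2.
have ds (t : R) : is_derive t 1 ( *%R s1) s1.
  by apply: is_derive_eq; rewrite /GRing.scale /=; ring.
have dx (t : R) : is_derive t 1 x (horopoint_deriv1 u v (s1 * t) * s1).
  have [dX _] := is_derive_horopoint (s1 * t) Duv.
  exact: (is_derive1_comp dX (ds t)).
have dy (t : R) : is_derive t 1 y (horopoint_deriv2 u v (s1 * t) * s1).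
  have [_ dY] := is_derive_horopoint (s1 * t) Duv.
  exact: (is_derive1_comp dY (ds t)).
have cs : continuous ( *%R s1).
  by move=> t; apply: cvgM; [exact: cvg_cst|exact: cvg_id].
have Cx : C1 x.
  split=> [t|]; first by have [] := dx t.
  rewrite (_ : derive1 x = fun t => horopoint_deriv1 u v (s1 * t) * s1).
    move=> t; apply: cvgM; last exact: cvg_cst.
    by apply: continuous_comp; [exact: cs|exact: cX].
  by apply/funext => t; rewrite derive1E derive_val.
have Cy : C1 y.
  split=> [t|]; first by have [] := dy t.
  rewrite (_ : derive1 y = fun t => horopoint_deriv2 u v (s1 * t) * s1).
    move=> t; apply: cvgM; last exact: cvg_cst.
    by apply: continuous_comp; [exact: cs|exact: cY].
  by apply/funext => t; rewrite derive1E derive_val.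
have path : [/\ C1 x /\ C1 y,
        {in `[0, 1] &, injective (fun t => (x t, y t))},
        (forall t, t \in `[0, 1] -> horocycle u (x t, y t))
      & (x 0, y 0) = edge_point u v /\ (x 1, y 1) = edge_point u w].
  have xyE t : (x t, y t) = horopoint u v (s1 * t).
    by rewrite /x /y; case: (horopoint _ _ _).
  split=> //.
  - by move=> s t _ _; rewrite !xyE => /(can_inj (horopointK Duv))/(mulfI s10).
  - by move=> t _; rewrite xyE; exact: horopointP.
  - by rewrite !xyE mulr0 mulr1 (edge_pointE Duv) arc_coordK.
rewrite /generalized_angle; apply: get_subset1.
  by exists x, y; case: (path) => *; split=> //; rewrite len.
by move=> _ _ [x1 [y1 [? ? ? ? ->]]] [x2 [y2 [? ? ? ? ->]]]; rewrite !len.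
Qed.
End ArcLength.

(** * Isometries and ideal triangles *)

Section PlaneIsometries.
Variable R : realType.
Implicit Types (u v w x : 'cV[R]_2) (g : 'M[R]_2) (a b : R).

Lemma ord2E (i : 'I_2) : i = 0 \/ i = 1.
Proof. by case: i => [[|[|//]] ?]; [left|right]; apply/val_inj. Qed.

Lemma cV2P u v : u 0 0 = v 0 0 -> u 1 0 = v 1 0 -> u = v.
Proof.
by move=> e0 e1; apply/colP => i; have [->|->] := ord2E i.
Qed.

Lemma mulmx_cV2 g u i : (g *m u) i 0 = g i 0 * u 0 0 + g i 1 * u 1 0.
Proof.
rewrite mxE big_ord_recl big_ord1.
by congr (_ * _ + g i _ * u _ 0); apply/val_inj.
Qed.

Lemma det_mx2 g : \det g = g 0 0 * g 1 1 - g 0 1 * g 1 0.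
Proof.
rewrite (expand_det_row _ ord0) big_ord_recl big_ord1 /cofactor.
have -> : row' (ord0 : 'I_2) (col' ord0 g) = (g 1 1)%:M.
  rewrite [LHS]mx11_scalar !mxE; congr ((g _ _)%:M); exact/val_inj.
have -> : row' (ord0 : 'I_2) (col' (lift ord0 ord0) g) = (g 1 0)%:M.
  rewrite [LHS]mx11_scalar !mxE; congr ((g _ _)%:M); exact/val_inj.
have -> : lift ord0 ord0 = 1 :> 'I_2 by exact/val_inj.
by rewrite !det_scalar1 /= expr0 expr1 mul1r mulN1r mulrN.
Qed.

Lemma det2_mulmx g u v : det2 (g *m u) (g *m v) = \det g * det2 u v.
Proof. by rewrite /det2 !mulmx_cV2 det_mx2; ring. Qed.

Lemma det2Z a b u v : det2 (a *: u) (b *: v) = a * b * det2 u v.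
Proof. by rewrite /det2 !mxE; ring. Qed.

(** Cramer's rule: two columns with a nonzero determinant are a basis. *)
Lemma det2_cramer u v w : det2 u v *: w = det2 w v *: u + det2 u w *: v.
Proof. by apply: cV2P; rewrite !mxE /det2; ring. Qed.

Lemma det2_inj u v x y : det2 u v != 0 ->
  det2 u x = det2 u y -> det2 v x = det2 v y -> x = y.
Proof.
move=> D0 e0 e1; apply: (scalerI D0).
by rewrite !(det2_cramer u v) e0 ![det2 _ v]det2C e1.
Qed.

Lemma isometry_sqr_det g : is_isometry g -> \det g ^+ 2 = 1.
Proof. by case=> ->; rewrite ?sqrrN expr1n. Qed.

Lemma norm_det2_isometry g u v :
  is_isometry g -> `|det2 (g *m u) (g *m v)| = `|det2 u v|.
Proof. by rewrite det2_mulmx normrM; case=> ->; rewrite ?normrN normr1 mul1r. Qed.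

Lemma is_isometryM g g' : is_isometry g -> is_isometry g' -> is_isometry (g *m g').
Proof.
rewrite /is_isometry det_mulmx.
by case=> -> [] ->; rewrite ?mulrNN ?mulN1r ?mulrN1 ?mulr1 ?mul1r;
  [left|right|right|left].
Qed.

Lemma is_isometry1 : is_isometry (1%:M : 'M[R]_2).
Proof. by left; rewrite det1. Qed.

Lemma eq_upto_signP m n (A B : 'M[R]_(m, n)) :
  eq_upto_sign A B <-> exists b : bool, B = (-1) ^+ b *: A.
Proof.
split=> [[->|->]|[[] ->]].
- by exists false; rewrite expr0 scale1r.
- by exists true; rewrite expr1 scaleN1r opprK.
- by right; rewrite expr1 scaleN1r opprK.
- by left; rewrite expr0 scale1r.
Qed.

Lemma eq_upto_sign_refl m n (A : 'M[R]_(m, n)) : eq_upto_sign A A.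
Proof. by left. Qed.

Lemma eq_upto_sign_sym m n (A B : 'M[R]_(m, n)) :
  eq_upto_sign A B -> eq_upto_sign B A.
Proof. by case=> ->; [left|right; rewrite opprK]. Qed.

Lemma eq_upto_sign_trans m n (A B C : 'M[R]_(m, n)) :
  eq_upto_sign A B -> eq_upto_sign B C -> eq_upto_sign A C.
Proof. by case=> -> [] ->; rewrite ?opprK; [left|right|right|left]. Qed.

Lemma eq_upto_signM m n p (g : 'M[R]_(m, n)) (u v : 'M[R]_(n, p)) :
  eq_upto_sign u v -> eq_upto_sign (g *m u) (g *m v).
Proof. by case=> ->; [left|right; rewrite mulmxN]. Qed.

Lemma norm_det2_upto_sign u v u' v' : eq_upto_sign u u' -> eq_upto_sign v v' ->
  `|det2 u' v'| = `|det2 u v|.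
Proof.
move=> /eq_upto_signP[b ->] /eq_upto_signP[c ->].
by rewrite det2Z !normrM !normr_sign !mul1r.
Qed.

(** Its sign tells on which side of the geodesic uv the ideal point w lies. *)
Definition side u v w : R := det2 u w * det2 v w.

Lemma sideC u v w : side u v w = side v u w.
Proof. by rewrite /side mulrC. Qed.

Lemma side_isometry g u v w : is_isometry g ->
  side (g *m u) (g *m v) (g *m w) = side u v w.
Proof.
move=> gI; rewrite /side !det2_mulmx mulrACA -expr2 isometry_sqr_det//.
by rewrite mul1r.
Qed.

Lemma sideZ (a b c : R) u v w :
  side (a *: u) (b *: v) (c *: w) = a * b * c ^+ 2 * side u v w.
Proof. by rewrite /side !det2Z; ring. Qed.

(** Horodisks determine their columns only up to sign, so [side] alone is not
    well defined; the relative position of two points w and x is. *)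
Lemma side2_upto_sign u v w x u' v' w' x' :
  eq_upto_sign u u' -> eq_upto_sign v v' ->
  eq_upto_sign w w' -> eq_upto_sign x x' ->
  side u' v' w' * side u' v' x' = side u v w * side u v x.
Proof.
move=> /eq_upto_signP[a ->] /eq_upto_signP[b ->].
move=> /eq_upto_signP[c ->] /eq_upto_signP[d ->].
rewrite !sideZ !sqrr_sign !mulr1 mulrACA -expr2 exprMn !sqrr_sign mulr1.
by rewrite mul1r.
Qed.

(** Two isometries that agree on the horodisks of u and v differ at most by the
    reflection in the geodesic uv, which exchanges its sides. *)
Lemma isometry_upto_sign g g' u v w U V : is_isometry g -> is_isometry g' ->
  det2 u v != 0 ->
  eq_upto_sign (g *m u) U -> eq_upto_sign (g' *m u) U ->
  eq_upto_sign (g *m v) V -> eq_upto_sign (g' *m v) V ->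
  0 < side U V (g *m w) * side U V (g' *m w) -> eq_upto_sign g g'.
Proof.
move=> gI gI' D0 gu gu' gv gv' sgn.
have [a ea] : exists b : bool, g' *m u = (-1) ^+ b *: (g *m u).
  by apply/eq_upto_signP/(eq_upto_sign_trans gu)/eq_upto_sign_sym.
have [b eb] : exists b : bool, g' *m v = (-1) ^+ b *: (g *m v).
  by apply/eq_upto_signP/(eq_upto_sign_trans gv)/eq_upto_sign_sym.
suff eab : a = b.
  apply/eq_upto_signP; exists a.
  have e x : g' *m x = (-1) ^+ a *: (g *m x).
    have lin h : det2 u v *: (h *m x)
        = det2 x v *: (h *m u) + det2 u x *: (h *m v).
      by rewrite scalemxAr (det2_cramer u v) mulmxDr -!scalemxAr.
    apply: (scalerI D0); rewrite [RHS]scalerA [_ * (-1) ^+ a]mulrC -scalerA !lin.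
    by rewrite ea eb -eab scalerDr !scalerA ![(-1) ^+ a * _]mulrC.
  apply/matrixP => i j; have /colP/(_ i) := e (delta_mx j 0).
  by rewrite -!colE !mxE.
move: sgn; rewrite -(side2_upto_sign (eq_upto_sign_sym gu)
  (eq_upto_sign_sym gv) (eq_upto_sign_refl _) (eq_upto_sign_refl _)).
rewrite side_isometry//.
have : side (g' *m u) (g' *m v) (g' *m w) = side u v w by exact: side_isometry.
rewrite ea eb -[X in side _ _ X = _]scale1r sideZ expr1n mulr1 => <-.
rewrite -mulrA -expr2 -signr_addb.
case: (eqVneq a b) => // ab; rewrite (_ : a (+) b) ?expr1 ?mulN1r; last first.
  by case: a b ab {ea eb} => [] [].
by rewrite oppr_gt0 ltNge sqr_ge0.
Qed.

(** There are two linear maps that send u to u' and v to v' or - v'; they differ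
    by the reflection in u'v', so one of them sends w to the wanted side.  The
    sign of [e] selects the side: positive for the side of w', negative for the
    other. *)
Lemma isometry_exists u v w u' v' w' (e : R) :
  det2 u v != 0 -> det2 u w != 0 -> det2 v w != 0 ->
  det2 u' w' != 0 -> det2 v' w' != 0 ->
  `|det2 u v| = `|det2 u' v'| -> e != 0 ->
  exists g, [/\ is_isometry g, g *m u = u', eq_upto_sign (g *m v) v'
    & 0 < e * (side u' v' (g *m w) * side u' v' w')].
Proof.
move=> D0 uw vw uw' vw' eD e0; set D := det2 u v.
have D0' : det2 u' v' != 0 by rewrite -normr_gt0 -eD normr_gt0.
pose G (s : R) : 'M[R]_2 := \matrix_(i, j)
  if j == 0 then (v 1 0 * u' i 0 - s * u 1 0 * v' i 0) / D
  else (s * u 0 0 * v' i 0 - v 0 0 * u' i 0) / D.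
have Gu s : G s *m u = u'.
  by apply: cV2P; rewrite mulmx_cV2 !mxE /=; move: D0; rewrite /D /det2 => D0; field.
have Gv s : G s *m v = s *: v'.
  by apply: cV2P; rewrite mulmx_cV2 !mxE /=; move: D0; rewrite /D /det2 => D0; field.
have Gdet s : \det (G s) = s * det2 u' v' / D.
  apply: (mulIf D0); rewrite mulfVK// -det2_mulmx Gu Gv -[u' in LHS]scale1r det2Z.
  by rewrite mul1r.
have Gw s : D *: (G s *m w) = det2 w v *: u' + (s * det2 u w) *: v'.
  rewrite scalemxAr (det2_cramer u v) mulmxDr -!scalemxAr Gu Gv.
  by rewrite scalerA [s * _]mulrC.
have Gside s : side u' v' (G s *m w)
    = s * (side u v w * det2 u' v' ^+ 2 / D ^+ 2).
  have e1 : det2 u' (G s *m w) = s * det2 u w * det2 u' v' / D.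
    apply: (mulIf D0); rewrite mulfVK//.
    have -> : det2 u' (G s *m w) * D = det2 u' (D *: (G s *m w)).
      by rewrite /det2 !mxE; ring.
    by rewrite Gw /det2 !mxE; ring.
  have e2 : det2 v' (G s *m w) = det2 v w * det2 u' v' / D.
    apply: (mulIf D0); rewrite mulfVK//.
    have -> : det2 v' (G s *m w) * D = det2 v' (D *: (G s *m w)).
      by rewrite /det2 !mxE; ring.
    by rewrite Gw /det2 !mxE; ring.
  by rewrite /side e1 e2; field.
(* the second reflection changes the sign of this number *)
pose c := e * (side u v w * det2 u' v' ^+ 2 / D ^+ 2 * side u' v' w').
have c0 : c != 0.
  by rewrite !mulf_neq0 ?invr_eq0 ?expf_neq0.
pose b := c < 0; exists (G ((-1) ^+ b)); split.
- have : `|\det (G ((-1) ^+ b))| = 1.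
    by rewrite Gdet !normrM normr_sign mul1r normfV -eD divff// normr_eq0.
  by move/eqP; rewrite eqr_norml => /andP[/orP[]/eqP d _]; [left|right].
- exact: Gu.
- by apply/eq_upto_signP; exists b; rewrite Gv signrZK.
- rewrite Gside -[X in e * X]mulrA mulrCA -/c.
  by rewrite -normrEsign ?num_real// normr_gt0.
Qed.

(** A decorated ideal triangle is determined by its edge lengths: the isometry
    that matches the edge uv and the side of w also matches w, because w is
    known from its determinants with u and v up to a common sign. *)
Lemma congruent_triangles u v w u' v' w' :
  det2 u v != 0 -> det2 u w != 0 -> det2 v w != 0 ->
  `|det2 u v| = `|det2 u' v'| -> `|det2 u w| = `|det2 u' w'| ->
  `|det2 v w| = `|det2 v' w'| ->
  exists g, [/\ is_isometry g, eq_upto_sign (g *m u) u',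
    eq_upto_sign (g *m v) v' & eq_upto_sign (g *m w) w'].
Proof.
move=> uv uw vw euv euw evw.
have uv' : det2 u' v' != 0 by rewrite -normr_gt0 -euv normr_gt0.
have uw' : det2 u' w' != 0 by rewrite -normr_gt0 -euw normr_gt0.
have vw' : det2 v' w' != 0 by rewrite -normr_gt0 -evw normr_gt0.
have [g [gI gu gv gw]] := isometry_exists uv uw vw uw' vw' euv (oner_neq0 R).
exists g; split=> //; first by left.
rewrite mul1r in gw.
have [a ea] : exists a : bool, det2 u' w' = (-1) ^+ a * det2 u' (g *m w).
  have : `|det2 u' (g *m w)| = `|det2 u' w'|.
    by rewrite -{1}gu norm_det2_isometry.
  move=> e; case: (eqVneq (det2 u' w') (det2 u' (g *m w))) => [->|ne].
    by exists false; rewrite expr0 mul1r.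
  exists true; rewrite expr1 mulN1r.
  by move/eqP: e; rewrite eqr_norm2 eq_sym (negPf ne) => /eqP ->; rewrite opprK.
have [b eb] : exists b : bool, det2 v' w' = (-1) ^+ b * det2 v' (g *m w).
  have : `|det2 v' (g *m w)| = `|det2 v' w'|.
    rewrite -evw -(norm_det2_isometry v w gI).
    by apply: norm_det2_upto_sign => //; left.
  move=> e; case: (eqVneq (det2 v' w') (det2 v' (g *m w))) => [->|ne].
    by exists false; rewrite expr0 mul1r.
  exists true; rewrite expr1 mulN1r.
  by move/eqP: e; rewrite eqr_norm2 eq_sym (negPf ne) => /eqP ->; rewrite opprK.
suff eab : a = b.
  apply/eq_upto_signP; exists a; apply: (det2_inj uv').
    by rewrite -[u' in RHS]scale1r det2Z mul1r.
  by rewrite -[v' in RHS]scale1r det2Z mul1r eab.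
move: gw; rewrite {2}/side ea eb [X in _ * X]mulrACA -signr_addb.
rewrite -/(side u' v' (g *m w)) mulrCA -expr2.
case: (eqVneq a b) => // ab; rewrite (_ : a (+) b) ?expr1 ?mulN1r; last first.
  by case: a b ab {ea eb} => [] [].
by rewrite oppr_gt0 ltNge sqr_ge0.
Qed.

Lemma triangle_exists (p : 'I_3 -> R) : (forall i, 0 < p i) ->
  exists u : 'I_3 -> 'cV[R]_2,
    forall i, `|det2 (u (ordS i)) (u (ord_pred i))| = p i.
Proof.
move=> p0; pose col (a b : R) : 'cV[R]_2 := \col_i if i == 0 then a else b.
have colE a b a' b' : det2 (col a b) (col a' b') = a * b' - b * a'.
  by rewrite /det2 !mxE.
pose i0 : 'I_3 := @Ordinal 3 0 isT; pose i1 : 'I_3 := @Ordinal 3 1 isT.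
pose i2 : 'I_3 := @Ordinal 3 2 isT.
exists (fun i => if i == i0 then col 1 0 else if i == i1 then col 0 (p i2)
                 else col (p i0 / p i2) (p i1)).
move=> i; have [->|->|->] : [\/ i = i0, i = i1 | i = i2].
- case: i => [[|[|[|//]]] ?];
   by [apply: Or31; exact/val_inj|apply: Or32; exact/val_inj|apply: Or33; exact/val_inj].
- have [-> ->] : ordS i0 = i1 /\ ord_pred i0 = i2 by split; exact/val_inj.
  rewrite /= colE mul0r sub0r normrN mulrC mulfVK ?lt0r_neq0//.
  by rewrite gtr0_norm.
- have [-> ->] : ordS i1 = i2 /\ ord_pred i1 = i0 by split; exact/val_inj.
  by rewrite /= colE mulr0 sub0r normrN mulr1 gtr0_norm.
- have [-> ->] : ordS i2 = i0 /\ ord_pred i2 = i1 by split; exact/val_inj.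
  by rewrite /= colE mul0r mul1r subr0 gtr0_norm.
Qed.
End PlaneIsometries.

(** * Gluing decorated triangles *)

Section Surface.
Variables (R : realType) (T : triangulated_surface).
Local Notation F := (tri_F T).
Local Notation V := (tri_V T).
Local Notation E := (tri_E T).
Local Notation glue := (@tri_glue T).
Implicit Types (f : F) (i j k : 'I_3) (B : F -> 'I_3 -> 'cV[R]_2).

Lemma ord3P i k : [\/ k = i, k = ordS i | k = ord_pred i].
Proof.
case: i k => [[|[|[|//]]] ?] [[|[|[|//]]] ?];
 by [apply: Or31; exact/val_inj|apply: Or32; exact/val_inj|apply: Or33; exact/val_inj].
Qed.

Lemma ordS_neq i : ordS i != i.
Proof. by case: i => [[|[|[|//]]] ?]. Qed.

Lemma ord_pred_neq i : ord_pred i != i.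
Proof. by case: i => [[|[|[|//]]] ?]. Qed.

Lemma ordS_neq_pred i : ordS i != ord_pred i.
Proof. by case: i => [[|[|[|//]]] ?]. Qed.

Lemma ordSS i : ordS (ordS i) = ord_pred i.
Proof. by case: i => [[|[|[|//]]] ?]; exact/val_inj. Qed.

Lemma ord_pred_pred i : ord_pred (ord_pred i) = ordS i.
Proof. by case: i => [[|[|[|//]]] ?]; exact/val_inj. Qed.

Lemma sum_ord3 (M : nmodType) (G : 'I_3 -> M) i :
  \sum_k G k = G i + G (ordS i) + G (ord_pred i).
Proof.
rewrite (bigD1 i)//= (bigD1 (ordS i)) ?ordS_neq//= (bigD1 (ord_pred i))/=; last first.
  by rewrite ord_pred_neq eq_sym ordS_neq_pred.
rewrite big1 ?addr0 ?addrA// => k /andP[/andP[ki kS] kp].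
by case: (ord3P i k) ki kS kp => ->; rewrite eqxx.
Qed.

Definition neighbour f i : F := (glue (f, i)).1.
(** For k != i, [across f i k] is the vertex identified with the vertex k of f.
    The vertex i is not identified with [across f i i]: both face the common
    edge. *)
Definition across f i : {perm 'I_3} := (glue (f, i)).2.

Lemma across_neq f i k : k != i -> across f i k != across f i i.
Proof. by rewrite (inj_eq perm_inj). Qed.

Lemma neighbourK f i : neighbour (neighbour f i) (across f i i) = f.
Proof. exact: (congr1 fst (tri_glueK (f, i))). Qed.

Lemma acrossK f i k : across (neighbour f i) (across f i i) (across f i k) = k.
Proof.
have -> : across (neighbour f i) (across f i i) = ((across f i)^-1)%g :=
  congr1 snd (tri_glueK (f, i)).
by rewrite permK.
Qed.

Lemma tri_edge_neighbour f i : tri_edge (neighbour f i, across f i i) = tri_edge (f, i).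
Proof. by apply/esym/tri_edge_eq; right. Qed.

Definition nondegenerate B := forall f i j, i != j -> det2 (B f i) (B f j) != 0.

(** Penner's lambda length, exp (l / 2) for the edge of length l opposite to the
    vertex i of f. *)
Definition lambda B f i : R := `|det2 (B f (ordS i)) (B f (ord_pred i))|.

Lemma lambda_gt0 B f i : nondegenerate B -> 0 < lambda B f i.
Proof. by move=> Bn; rewrite normr_gt0 Bn// ordS_neq_pred. Qed.

Lemma norm_det2_lambda B f i j k : j != i -> k != i -> j != k ->
  `|det2 (B f j) (B f k)| = lambda B f i.
Proof.
case: (ord3P i j) (ord3P i k) => -> [] ->; rewrite ?eqxx// => _ _ _.
by rewrite det2C normrN.
Qed.

(** The last clause, that f and its neighbour lie on different sides of the
    common edge, is required for both orders of its endpoints j and k so that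
    it transports along [across] without a choice of orientation. *)
Definition glues B f i (g : 'M[R]_2) := [/\ is_isometry g,
  forall k, k != i -> eq_upto_sign (g *m B f k) (B (neighbour f i) (across f i k))
  & forall j k, j != i -> k != i -> j != k ->
    side (B (neighbour f i) (across f i j)) (B (neighbour f i) (across f i k))
         (g *m B f i)
    * side (B (neighbour f i) (across f i j)) (B (neighbour f i) (across f i k))
         (B (neighbour f i) (across f i i)) < 0].

Lemma glues_lambda B f i g : glues B f i g ->
  lambda B (neighbour f i) (across f i i) = lambda B f i.
Proof.
case=> gI gV _.
rewrite -(@norm_det2_lambda _ _ _ (across f i (ordS i)) (across f i (ord_pred i)));
  rewrite ?across_neq ?ordS_neq ?ord_pred_neq//; last first.
  by rewrite (inj_eq perm_inj) ordS_neq_pred.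
rewrite (norm_det2_upto_sign (gV _ (ordS_neq i)) (gV _ (ord_pred_neq i))).
by rewrite norm_det2_isometry.
Qed.

(** Gluing isometries preserve determinants up to sign, so the length of an edge
    can be computed in either adjacent triangle. *)
Lemma lambda_edge B s s' : (forall f i, exists g, glues B f i g) ->
  tri_edge s = tri_edge s' -> lambda B s.1 s.2 = lambda B s'.1 s'.2.
Proof.
move=> Bg /tri_edge_eq[->//|->]; case: s => f i /=.
by have [g /glues_lambda] := Bg f i.
Qed.

(** Both products send f to the decorated triangle of [B'] next to it, agreeing
    on the common edge; both place f opposite to the neighbour, hence on the
    same side. *)
Lemma glues_unique B B' f i (g g' m m' : 'M[R]_2) : nondegenerate B ->
  is_isometry m -> is_isometry m' ->
  (forall k, eq_upto_sign (m *m B f k) (B' f k)) ->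
  (forall k, eq_upto_sign (m' *m B (neighbour f i) k) (B' (neighbour f i) k)) ->
  glues B f i g -> glues B' f i g' -> eq_upto_sign (g' *m m) (m' *m g).
Proof.
move=> Bn mI m'I mB m'B [gI gV gS] [g'I g'V g'S].
have gV' k : k != i ->
    eq_upto_sign (m' *m g *m B f k) (B' (neighbour f i) (across f i k)).
  by move=> ki; rewrite -mulmxA; apply: eq_upto_sign_trans (m'B _);
    apply: eq_upto_signM; exact: gV.
have g'V' k : k != i ->
    eq_upto_sign (g' *m m *m B f k) (B' (neighbour f i) (across f i k)).
  by move=> ki; rewrite -mulmxA; apply: eq_upto_sign_trans (g'V _ ki);
    apply: eq_upto_signM; exact: mB.
have Sn := ordS_neq i; have pn := ord_pred_neq i.
apply: (@isometry_upto_sign _ _ _ (B f (ordS i)) (B f (ord_pred i)) (B f i)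
   _ _ _ _ _ (g'V' _ Sn) (gV' _ Sn) (g'V' _ pn) (gV' _ pn));
  [exact: is_isometryM|exact: is_isometryM|by rewrite Bn ?ordS_neq_pred|].
set U := B' _ _; set W := B' _ _.
set w := B' (neighbour f i) (across f i i).
have h : side U W (g' *m m *m B f i) * side U W w < 0.
  have e : eq_upto_sign (g' *m B' f i) (g' *m m *m B f i).
    by rewrite -mulmxA; apply/eq_upto_signM/eq_upto_sign_sym; exact: mB.
  rewrite (side2_upto_sign (eq_upto_sign_refl _) (eq_upto_sign_refl _) e
    (eq_upto_sign_refl _)).
  by apply: g'S; rewrite ?ordS_neq_pred.
have h' : side U W (m' *m g *m B f i) * side U W w < 0.
  rewrite (side2_upto_sign (m'B _) (m'B _) (eq_upto_sign_refl _) (m'B _)).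
  rewrite -mulmxA !side_isometry//.
  by apply: gS; rewrite ?ordS_neq_pred.
have w0 : 0 < side U W w ^+ 2.
  rewrite exprn_even_gt0//=; apply/eqP => w0; move: h.
  by rewrite w0 mulr0 ltxx.
rewrite -(pmulr_lgt0 _ w0) expr2 mulrACA.
by rewrite nmulr_rgt0.
Qed.


Lemma is_decorationP (X : hyperbolic_structure R T) B : is_decoration X B ->
  nondegenerate B /\ forall f i, glues B f i (hs_glue X f i).
Proof.
case=> BX Bg.
have BZ f k : exists2 c : R, c != 0 & B f k = c *: hs_vert X f k := BX f k.
split=> [f i j ij|f i].
  have [c c0 ->] := BZ f i; have [d d0 ->] := BZ f j.
  by rewrite det2Z !mulf_neq0// hs_vertP.
split=> [|k ki|]; [exact: hs_glue_isom|exact: Bg|].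
set P := fun j k => side (B (neighbour f i) (across f i j))
    (B (neighbour f i) (across f i k)) (hs_glue X f i *m B f i)
  * side (B (neighbour f i) (across f i j)) (B (neighbour f i) (across f i k))
    (B (neighbour f i) (across f i i)) < 0.
suff PSp : P (ordS i) (ord_pred i).
  move=> j k; case: (ord3P i j) (ord3P i k) => -> [] ->; rewrite ?eqxx// => _ _ _.
  by rewrite sideC [X in _ * X]sideC.
rewrite /P (side2_upto_sign (Bg _ _ _ (ordS_neq i)) (Bg _ _ _ (ord_pred_neq i))
   (eq_upto_sign_refl _) (eq_upto_sign_refl _)).
have [a a0 ->] := BZ f (ordS i); have [b b0 ->] := BZ f (ord_pred i).
have [c c0 ->] := BZ f i; have [d d0 ->] := BZ (neighbour f i) (across f i i).
rewrite -!scalemxAr !sideZ.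
have := hs_glue_side X f i; rewrite /Defs.separated -!/(side _ _ _) => h.
rewrite mulrACA pmulr_rlt0//.
have -> : a * b * c ^+ 2 * (a * b * d ^+ 2) = (a * b * c * d) ^+ 2 by ring.
by rewrite exprn_even_gt0//= !mulf_neq0.
Qed.

Lemma decoration_glues (X : hyperbolic_structure R T) B : is_decoration X B ->
  forall f i, exists g, glues B f i g.
Proof. by move=> /is_decorationP[_ Bg] f i; exists (hs_glue X f i). Qed.

Lemma corner_angleE B f k : nondegenerate B ->
  corner_angle B f k = lambda B f k / (lambda B f (ordS k) * lambda B f (ord_pred k)).
Proof.
move=> Bn; have Sn := ordS_neq k; have pn := ord_pred_neq k.
have Sp := ordS_neq_pred k.
rewrite /corner_angle generalized_angleE ?Bn//; try by rewrite eq_sym.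
congr (_ / _); rewrite mulrC; congr (_ * _);
 by apply: norm_det2_lambda => //; rewrite eq_sym.
Qed.

Lemma corner_angle_gt0 B f k : nondegenerate B -> 0 < corner_angle B f k.
Proof.
by move=> Bn; rewrite corner_angleE// divr_gt0 ?mulr_gt0 ?lambda_gt0.
Qed.

Lemma horocycle_length_gt0 B v : nondegenerate B -> 0 < horocycle_length B v.
Proof.
move=> Bn; have [c cv] := tri_vert_surj v; rewrite /horocycle_length (bigD1 c)//=.
rewrite ltr_pwDl ?corner_angle_gt0//.
by apply: sumr_ge0 => c' _; rewrite ltW// corner_angle_gt0.
Qed.

Lemma eq_horocycle_length B B' : nondegenerate B -> nondegenerate B' ->
  (forall f i, lambda B f i = lambda B' f i) ->
  horocycle_length B =1 horocycle_length B'.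
Proof.
move=> Bn B'n e v; apply: eq_bigr => c _.
by rewrite !corner_angleE// !e.
Qed.

(** Rescaling the two other horodisks does not change the arc cut out on the
    horocycle of k; rescaling its own column changes the arc by the inverse
    square. *)
Lemma corner_angle_scale B (c : F -> 'I_3 -> R) f k : nondegenerate B ->
  (forall f k, c f k != 0) ->
  corner_angle (fun f k => c f k *: B f k) f k = corner_angle B f k / c f k ^+ 2.
Proof.
move=> Bn c0.
have Bn' : nondegenerate (fun f k => c f k *: B f k).
  by move=> f' i j ij; rewrite det2Z !mulf_neq0 ?Bn.
rewrite !corner_angleE// /lambda !det2Z !normrM ordSS ordSK ord_predK ord_pred_pred.
have n0 f' k' : `|c f' k'| != 0 by rewrite normr_eq0.
have m0 i j : i != j -> `|det2 (B f i) (B f j)| != 0.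
  by move=> ij; rewrite normr_eq0 Bn.
rewrite -[in RHS](real_normK (num_real (c f k))).
field.
by rewrite !n0 !m0// ?(ord_pred_neq, ordS_neq)// eq_sym ?ordS_neq ?ord_pred_neq.
Qed.
End Surface.

(** * Penner's length coordinates *)

Section LengthMap.
Variables (R : realType) (T : triangulated_surface).
Local Notation F := (tri_F T).
Local Notation V := (tri_V T).
Local Notation E := (tri_E T).
Implicit Types (f : F) (i j k : 'I_3) (B : F -> 'I_3 -> 'cV[R]_2).
Implicit Types (X : hyperbolic_structure R T) (dr : decorated_teichmueller_space R T).

Lemma tri_vert_across f i k : k != i ->
  tri_vert (neighbour f i, across f i k) = tri_vert (f, k).
Proof.
move=> ki; apply/esym/tri_vert_eq; apply: connect1.
by apply/existsP; exists i; rewrite eq_sym ki /=.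
Qed.

(** Corners matched by the gluing belong to the same puncture, so rescaling the
    horodisks by a function of the puncture keeps them matched. *)
Lemma decoration_scale X B (c : V -> R) : (forall v, c v != 0) ->
  is_decoration X B ->
  is_decoration X (fun f k => c (tri_vert (f, k)) *: B f k).
Proof.
move=> c0 [BX Bg]; split=> [f k|f i k ki].
  have [a a0 ->] := BX f k; exists (c (tri_vert (f, k)) * a).
    by rewrite mulf_neq0.
  by rewrite scalerA.
rewrite tri_vert_across// -scalemxAr.
by case: (Bg f i k ki) => ->; [left|right; rewrite scalerN].
Qed.

Lemma horocycle_length_scale B (c : V -> R) v : nondegenerate B -> (forall v, c v != 0) ->
  horocycle_length (fun f k => c (tri_vert (f, k)) *: B f k) v
    = horocycle_length B v / c v ^+ 2.
Proof.
move=> Bn c0; rewrite /horocycle_length mulr_suml; apply: eq_bigr => -[f k] /eqP e.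
rewrite (corner_angle_scale (c := fun f k => c (tri_vert (f, k))))//=.
by rewrite e.
Qed.

Lemma decoration_exists X (r : V -> {posnum R}) : has_cusp_ends X ->
  exists B, is_decoration X B /\ forall v, horocycle_length B v = (r v)%:num.
Proof.
case=> B Bd; have [Bn _] := is_decorationP Bd.
(* lengths are divided by the square of the scale *)
pose c v := Num.sqrt (horocycle_length B v / (r v)%:num).
have q0 v : 0 < horocycle_length B v / (r v)%:num.
  by rewrite divr_gt0// horocycle_length_gt0.
have c0 v : c v != 0 by rewrite lt0r_neq0// sqrtr_gt0.
exists (fun f k => c (tri_vert (f, k)) *: B f k); split.
  exact: decoration_scale.
move=> v; rewrite horocycle_length_scale// sqr_sqrtr ?ltW// invf_div.
by rewrite mulrC mulfVK// lt0r_neq0// horocycle_length_gt0.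
Qed.

(** The ratio of two decorations at a corner is constant in absolute value along
    [corner_adj], since the gluing isometries transport both decorations; its
    connected components are the punctures. *)
Lemma decoration_ratio X B B' : is_decoration X B -> is_decoration X B' ->
  exists2 c : V -> R, (forall v, 0 < c v) & forall f k,
    B' f k = c (tri_vert (f, k)) *: B f k \/ B' f k = - (c (tri_vert (f, k)) *: B f k).
Proof.
move=> Bd Bd'; have [Bn _] := is_decorationP Bd.
case: Bd => BX Bg; case: Bd' => BX' Bg'.
have /choice[a aE] : forall s : F * 'I_3, exists a : R,
    a != 0 /\ B' s.1 s.2 = a *: B s.1 s.2.
  case=> f k /=; have [b b0 eB] := BX f k.
  have [b' b'0 eB'] := BX' f k.
  exists (b' / b); rewrite mulf_neq0 ?invr_eq0//; split=> //.
  by rewrite eB eB' scalerA mulfVK.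
have B0 s : B s.1 s.2 != 0.
  apply/eqP => e; have := Bn s.1 s.2 (ordS s.2).
  by rewrite e eq_sym ordS_neq /det2 !mxE !mul0r subrr eqxx => /(_ isT).
have step s t : corner_adj (@tri_glue T) s t -> `|a s| = `|a t|.
  case: s => f k /existsP[i /andP[ik /eqP ->]]; rewrite /= in ik *.
  rewrite eq_sym in ik; pose s' := (neighbour f i, across f i k); rewrite -/s'.
  have /eq_upto_signP[b eb] : eq_upto_sign (hs_glue X f i *m B f k)
    (B s'.1 s'.2) := Bg f i k ik.
  have /eq_upto_signP[c ec] : eq_upto_sign (hs_glue X f i *m B' f k)
    (B' s'.1 s'.2) := Bg' f i k ik.
  have [_ /= e] := aE (f, k); have [_ e'] := aE s'.
  rewrite e -scalemxAr scalerA in ec.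
  have := B0 s'; rewrite eb scaler_eq0 negb_or => /andP[_ g0].
  move: e'; rewrite ec eb scalerA => /eqP.
  rewrite -subr_eq0 -scalerBl scaler_eq0 (negPf g0) orbF subr_eq0 => /eqP.
  by move/(congr1 Num.norm); rewrite !normrM !normr_sign mul1r mulr1.
have vert s s' : tri_vert s = tri_vert s' -> `|a s| = `|a s'|.
  move=> /tri_vert_eq /connectP[p]; elim: p s => [|t p IH] s /=; first by move=> _ ->.
  by move=> /andP[/step -> /IH]; apply.
pose c v := `|a (xchoose (tri_vert_surj v))|.
exists c => [v|f k]; first by rewrite normr_gt0; case: (aE (xchoose (tri_vert_surj v))).
have -> : c (tri_vert (f, k)) = `|a (f, k)|.
  by apply: vert; apply/eqP/(xchooseP (tri_vert_surj (tri_vert (f, k)))).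
have [_ /= ->] := aE (f, k); rewrite -scaleNr.
by case: (ger0P (a (f, k))) => _; [left|right; rewrite opprK].
Qed.

(** By [horocycle_length_scale], equal horocycle lengths force the positive ratio
    of the two decorations to be 1 at every puncture. *)
Lemma decoration_lambda_unique X B B' : is_decoration X B -> is_decoration X B' ->
  horocycle_length B =1 horocycle_length B' -> forall f i, lambda B f i = lambda B' f i.
Proof.
move=> Bd Bd' eL f i; have [c c0 cE] := decoration_ratio Bd Bd'.
have [Bn _] := is_decorationP Bd; have [B'n _] := is_decorationP Bd'.
have cn v : c v != 0 by rewrite lt0r_neq0.
pose B1 f k := c (tri_vert (f, k)) *: B f k.
have B1n : nondegenerate B1 by move=> f' j k jk; rewrite det2Z !mulf_neq0 ?Bn.
have eB1 f' j : lambda B1 f' j = lambda B' f' j.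
  have cB k : eq_upto_sign (B1 f' k) (B' f' k).
    by case: (cE f' k) => ->; [left|right; rewrite opprK].
  by apply/esym/norm_det2_upto_sign; exact: cB.
have c1 v : c v = 1.
  have := horocycle_length_scale v Bn cn.
  rewrite (eq_horocycle_length B1n B'n eB1) -eL => /eqP.
  rewrite eq_sym -subr_eq0 -[X in _ - X]mulr1 -mulrBr mulf_eq0.
  rewrite (gt_eqF (horocycle_length_gt0 v Bn))/= subr_eq0 => /eqP e.
  have : c v ^+ 2 = 1 by rewrite -[LHS]invrK e invr1.
  by move/eqP; rewrite sqrp_eq1 ?ltW// => /eqP.
by rewrite -eB1 /lambda /B1 !c1 !scale1r.
Qed.

Lemma horodisksP dr : is_decoration (sval (rep dr.1)) (horodisks dr) /\
  forall v, horocycle_length (horodisks dr) v = (dr.2 v)%:num.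
Proof.
rewrite /horodisks; apply: (@xgetPex _ _ [set B | is_decoration (sval (rep dr.1)) B /\
             forall v, horocycle_length B v = (dr.2 v)%:num]).
by apply: decoration_exists; exact: (svalP (rep dr.1)).
Qed.

(** [side_of] picks one of the two sides of the edge; [lambda_edge] says that the
    choice does not matter. *)
Lemma length_mapE dr f i :
  length_map dr 0 (enum_rank (tri_edge (f, i))) = 2 * ln (lambda (horodisks dr) f i).
Proof.
rewrite mxE enum_rankK /side_of.
have [Bd _] := horodisksP dr; have [Bn _] := is_decorationP Bd.
have := xchooseP (tri_edge_surj (tri_edge (f, i))).
case: (xchoose _) => f' i' /eqP e.
rewrite generalized_edge_lengthE ?Bn ?ordS_neq_pred//.
by congr (2 * ln _); exact: (lambda_edge (decoration_glues Bd) e).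
Qed.

Lemma lambda_length_map dr f i : lambda (horodisks dr) f i
  = expR (length_map dr 0 (enum_rank (tri_edge (f, i))) / 2).
Proof.
have [Bd _] := horodisksP dr; have [Bn _] := is_decorationP Bd.
by rewrite length_mapE mulrC mulKf// lnK// posrE lambda_gt0.
Qed.

(** Match the triangles one by one with [congruent_triangles]; the resulting
    isometries commute with the gluings by [glues_unique]. *)
Lemma isometric_decorated X X' B B' : is_decoration X B -> is_decoration X' B' ->
  (forall f i, lambda B f i = lambda B' f i) ->
  exists m : F -> 'M[R]_2, [/\ forall f, is_isometry (m f),
    forall f k, eq_upto_sign (m f *m B f k) (B' f k)
    & forall f i, eq_upto_sign (hs_glue X' f i *m m f) (m (neighbour f i) *m hs_glue X f i)].
Proof.
move=> Bd Bd' eL.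
have [Bn Bg] := is_decorationP Bd; have [B'n B'g] := is_decorationP Bd'.
pose i0 : 'I_3 := ord0.
have eD f i j : i != j -> `|det2 (B f i) (B f j)| = `|det2 (B' f i) (B' f j)|.
  move=> ij; have [k [ik jk]] : exists k, i != k /\ j != k.
    case: (ord3P i j) ij => ->; rewrite ?eqxx// => _.
      by exists (ord_pred i); rewrite eq_sym ord_pred_neq ordS_neq_pred.
    by exists (ordS i); rewrite eq_sym ordS_neq eq_sym ordS_neq_pred.
  by rewrite !(@norm_det2_lambda _ _ _ _ k).
have /choice[m mP] : forall f, exists g : 'M[R]_2,
    is_isometry g /\ forall k, eq_upto_sign (g *m B f k) (B' f k).
  move=> f; have S0 := ordS_neq i0; have p0 := ord_pred_neq i0.
  have Sp := ordS_neq_pred i0; rewrite eq_sym in S0; rewrite eq_sym in p0.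
  have [g [gI g0 g1 g2]] := congruent_triangles (Bn f _ _ S0) (Bn f _ _ p0)
    (Bn f _ _ Sp) (eD f _ _ S0) (eD f _ _ p0) (eD f _ _ Sp).
  by exists g; split=> // k; case: (ord3P i0 k) => ->.
exists m; split=> [f|f k|f i]; try by have [] := mP f.
have [mI mB] := mP f; have [m'I m'B] := mP (neighbour f i).
exact: (glues_unique Bn mI m'I mB m'B (Bg f i) (B'g f i)).
Qed.

(** The horocycle lengths are functions of the edge lengths, so the decorations
    have the same r; and the metrics are isometric by [isometric_decorated]. *)
Lemma length_map_inj : injective (@length_map R T).
Proof.
move=> dr dr' e.
have [Bd Br] := horodisksP dr; have [Bd' Br'] := horodisksP dr'.
have [Bn _] := is_decorationP Bd; have [Bn' _] := is_decorationP Bd'.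
have eL f i : lambda (horodisks dr) f i = lambda (horodisks dr') f i.
  by rewrite !lambda_length_map e.
have er : dr.2 = dr'.2.
  apply/funext => v; apply/val_inj.
  rewrite -[LHS]/((dr.2 v)%:num) -[RHS]/((dr'.2 v)%:num) -Br -Br'.
  exact: eq_horocycle_length.
have [m [mI mB mG]] := isometric_decorated Bd Bd' eL.
have ed : dr.1 = dr'.1.
  rewrite -[LHS]reprK -[RHS]reprK; apply/eqmodP/asboolP.
  exists m; split=> //= f k.
  have [a a0 ea] := Bd.1 f k; have [b b0 eb] := Bd'.1 f k.
  have /eq_upto_signP[s] := mB f k; rewrite ea eb -scalemxAr scalerA => e'.
  exists (b^-1 * ((-1) ^+ s * a)).
    by rewrite !mulf_neq0 ?invr_eq0// signr_eq0.
  by rewrite -scalerA -e' scalerK.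
by case: dr dr' er ed {e Bd Br Bd' Br' Bn Bn' eL mB mG} => d r [d' r'] /= -> ->.
Qed.

(** Being glued is symmetric: this is what makes [glues_unique] yield the
    involutivity condition on the gluing isometries. *)
Lemma glues_inv B f i (h : 'M[R]_2) :
  glues B (neighbour f i) (across f i i) h -> glues B f i (invmx h).
Proof.
case=> hI hV hS; have hU := isometry_unit hI.
have hK (k : 'I_3) : k != i ->
    eq_upto_sign (h *m B (neighbour f i) (across f i k)) (B f k).
  by move=> /(across_neq f) /hV; rewrite neighbourK acrossK.
have hinvI : is_isometry (invmx h).
  by rewrite /is_isometry det_inv; case: hI => ->; rewrite ?invrN invr1; auto.
split=> // [k ki|j k ji ki jk].
  rewrite -[B (neighbour f i) _](mulKmx hU).
  by apply/eq_upto_signM/eq_upto_sign_sym/hK.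
set U := B _ (across f i j); set W := B _ (across f i k).
have hside x : side U W x = side (h *m U) (h *m W) (h *m x).
  by rewrite side_isometry.
rewrite !hside mulKVmx// /U /W.
rewrite (side2_upto_sign (eq_upto_sign_sym (hK j ji)) (eq_upto_sign_sym (hK k ki))
  (eq_upto_sign_refl _) (eq_upto_sign_refl _)) mulrC.
have := hS _ _ (across_neq f ji) (across_neq f ki).
by rewrite neighbourK !acrossK (inj_eq perm_inj) => /(_ jk).
Qed.

Lemma glues_exists B f i : nondegenerate B ->
  lambda B (neighbour f i) (across f i i) = lambda B f i -> exists g, glues B f i g.
Proof.
move=> Bn eL; have Sp := ordS_neq_pred i; have S0 := ordS_neq i.
have p0 := ord_pred_neq i.
have aSp : across f i (ordS i) != across f i (ord_pred i).
  by rewrite (inj_eq perm_inj).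
have eD : `|det2 (B f (ordS i)) (B f (ord_pred i))|
    = `|det2 (B (neighbour f i) (across f i (ordS i)))
             (B (neighbour f i) (across f i (ord_pred i)))|.
  rewrite -[LHS]/(lambda B f i) -eL.
  by apply/esym/norm_det2_lambda; rewrite ?across_neq.
(* the sign -1 asks for the side of the edge not occupied by the neighbour *)
have N1 : (-1 : R) != 0 by rewrite oppr_eq0 oner_eq0.
have [g [gI gu gv gS]] := isometry_exists (Bn f _ _ Sp) (Bn f _ _ S0)
  (Bn f _ _ p0) (Bn _ _ _ (across_neq f S0)) (Bn _ _ _ (across_neq f p0)) eD
  N1.
exists g; split=> // [k|j k].
  by case: (ord3P i k) => ->; rewrite ?eqxx// => _; left.
rewrite mulN1r oppr_gt0 in gS.
case: (ord3P i j) (ord3P i k) => -> [] ->; rewrite ?eqxx// => _ _ _.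
by rewrite sideC [X in _ * X]sideC.
Qed.

Lemma structure_exists B : nondegenerate B ->
  (forall f i, lambda B (neighbour f i) (across f i i) = lambda B f i) ->
  exists X, is_decoration X B.
Proof.
move=> Bn eL.
have /choice[g gP] : forall s : F * 'I_3, exists g, glues B s.1 s.2 g.
  by case=> f i; exact: glues_exists.
have gK f i : eq_upto_sign (g (glued_side (@tri_glue T) (f, i)) *m g (f, i)) 1%:M.
  have gs := gP (glued_side (@tri_glue T) (f, i)).
  have hg := glues_inv gs; have [hI _ _] := gs; have hU := isometry_unit hI.
  have M1 f' k : eq_upto_sign (1%:M *m B f' k) (B f' k) by rewrite mul1mx; left.
  have := glues_unique Bn (is_isometry1 R) (is_isometry1 R) (M1 f) (M1 _)
    (gP (f, i)) hg.
  rewrite mulmx1 mul1mx => /(eq_upto_signM (g (glued_side (@tri_glue T) (f, i)))).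
  by rewrite mulmxV// => /eq_upto_sign_sym.
have gS f i : Defs.separated (g (f, i) *m B f (ordS i)) (g (f, i) *m B f (ord_pred i))
    (g (f, i) *m B f i) (B (neighbour f i) (across f i i)).
  have [gI gV gS] := gP (f, i).
  have := gS _ _ (ordS_neq i) (ord_pred_neq i) (ordS_neq_pred i).
  by rewrite (side2_upto_sign (gV _ (ordS_neq i)) (gV _ (ord_pred_neq i))
    (eq_upto_sign_refl _) (eq_upto_sign_refl _)).
have gI f i : is_isometry (g (f, i)) by have [] := gP (f, i).
have gV f i k : k != i -> eq_upto_sign (g (f, i) *m B f k)
    (B (neighbour f i) (across f i k)).
  by move=> ki; have [_ gV _] := gP (f, i); exact: (gV k ki).
have gV' f i k : k != i -> same_ideal_point (g (f, i) *m B f k)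
    (B (neighbour f i) (across f i k)).
  move=> ki; have /eq_upto_signP[b ->] := gV f i k ki; exists ((-1) ^+ b) => //.
  by rewrite signr_eq0.
exists (@HyperbolicStructure R T B (fun f i => g (f, i)) Bn gI
  (fun f i => gK f i) gV' gS).
split=> /= [f k|f i k ki]; last exact: gV.
by exists 1; rewrite ?scale1r ?oner_neq0.
Qed.

Lemma isometric_decoration (d d' : cusped_metric R T) B :
  isometric d d' -> is_decoration (sval d) B ->
  exists2 B', is_decoration (sval d') B' & forall f i, lambda B' f i = lambda B f i.
Proof.
case=> m [mI mV mG] [BX Bg].
exists (fun f k => m f *m B f k); last by move=> f i; exact: norm_det2_isometry.
split=> [f k|f i k ki].
  have [a a0 ->] := BX f k; have [b b0 eb] := mV f k.
  exists (a / b); first by rewrite mulf_neq0 ?invr_eq0.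
  by rewrite eb scalerA mulfVK// scalemxAr.
rewrite mulmxA; case: (mG f i) => ->; last rewrite mulNmx.
  by rewrite -mulmxA; apply: eq_upto_signM; exact: Bg.
rewrite -mulmxA; apply: (@eq_upto_sign_trans _ _ _ _
  (m (neighbour f i) *m (hs_glue (sval d) f i *m B f k))).
  by right.
by apply: eq_upto_signM; exact: Bg.
Qed.

(** Realize each triangle with the prescribed lengths, glue, and let r be the
    horocycle lengths of this decoration.  The chosen representative of the
    metric may be another structure, but it is isometric to this one and carries
    the transported decoration, which up to signs is the one selected by r. *)
Lemma length_map_surj (l : 'rV[R]_#|E|) : exists dr, length_map dr = l.
Proof.
pose ell f i := l 0 (enum_rank (tri_edge (f, i))).
have /choice[B BE] : forall f, exists u : 'I_3 -> 'cV[R]_2,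
    forall i, `|det2 (u (ordS i)) (u (ord_pred i))| = expR (ell f i / 2).
  move=> f; apply: (@triangle_exists R (fun i => expR (ell f i / 2))) => i.
  exact: expR_gt0.
have Bn : nondegenerate B.
  have h f i : det2 (B f (ordS i)) (B f (ord_pred i)) != 0.
    by rewrite -normr_gt0 BE expR_gt0.
  move=> f i j; case: (ord3P i j) => ->; rewrite ?eqxx// => _.
    by have := h f (ord_pred i); rewrite ord_predK ord_pred_pred.
  by have := h f (ordS i); rewrite ordSS ordSK det2C oppr_eq0.
have [X XB] : exists X, is_decoration X B.
  apply: structure_exists => // f i.
  by rewrite /lambda !BE /ell tri_edge_neighbour.
pose d0 : cusped_metric R T := exist _ X (ex_intro _ B XB).
pose r v : {posnum R} := PosNum (horocycle_length_gt0 v Bn).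
pose d : teichmueller_space R T := (\pi_(teichmueller_space R T) d0)%qT.
exists (d, r).
have iso : isometric d0 (rep d).
  suff /eqmodP/asboolP : (d0 = rep d %[mod teichmueller_space R T])%qT by [].
  by rewrite /rep reprK.
have [B' dB' eB'] := isometric_decoration iso XB.
have [dH rH] := horodisksP (d, r).
have [B'n _] := is_decorationP dB'.
have eH f i : lambda (horodisks (d, r)) f i = lambda B f i.
  rewrite -eB'; apply: (decoration_lambda_unique dH dB') => v.
  by rewrite rH /= (eq_horocycle_length B'n Bn eB').
apply/rowP => j; rewrite -[j]enum_valK.
have [[f i] /eqP <-] := tri_edge_surj (enum_val j).
by rewrite length_mapE eH /lambda BE expRK mulrC mulfVK.
Qed.
End LengthMap.

(** * Integrals as functions of an endpoint *)

Section IntegralPrimitive.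
Variable R : realType.
Implicit Types (phi : R -> R).

Lemma continuous_integrable_segment phi (a b : R) : continuous phi ->
  lebesgue_measure.-integrable `[a, b] (EFin \o phi).
Proof.
move=> cphi; apply: continuous_compact_integrable; first exact: segment_compact.
exact: continuous_subspaceT.
Qed.

Lemma Rintegral_split phi (a x b : R) : continuous phi -> a <= x -> x <= b ->
  Rintegral lebesgue_measure `[a, b] phi
    = Rintegral lebesgue_measure `[a, x] phi + Rintegral lebesgue_measure `[x, b] phi.
Proof.
move=> cphi ax xb; apply/eqP; rewrite addrC -subr_eq; apply/eqP.
rewrite Rintegral_itvB ?bnd_simp//; last exact: continuous_integrable_segment.
rewrite Rintegral_itv_obnd_cbnd//.
apply: integrableS (continuous_integrable_segment x b cphi) => //.
exact: subset_itv_oc_cc.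
Qed.

(** Near x the oriented integral from 0 differs by a constant from the integral
    from a fixed a below both 0 and x. *)
Lemma is_derive_oriented_integral phi (x : R) : continuous phi ->
  is_derive x 1 (fun y => oriented_integral 0 y phi) (phi x).
Proof.
move=> cphi; pose a := - (`|x| + 1); pose u := `|x| + 1.
have a0 : a < 0 by rewrite /a oppr_lt0 ltr_wpDl.
have ax : a < x by rewrite /a ltrNl (le_lt_trans (ler_norm _))// normrN ltrDl.
have xu : x < u by rewrite (le_lt_trans (ler_norm _))// ltrDl.
have [dF F'] := continuous_FTC1_closed xu
  (continuous_integrable_segment a u cphi) ax (cphi x).
have dF' : is_derive x 1 (fun y => Rintegral lebesgue_measure `[a, y] phi
    - Rintegral lebesgue_measure `[a, 0] phi) (phi x).
  have dF0 : is_derive x 1 (fun y => Rintegral lebesgue_measure `[a, y] phi) (phi x).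
    by split; [exact: dF|rewrite -derive1E; exact: F'].
  by apply: is_derive_eq; rewrite subr0.
apply: near_eq_is_derive dF'; near=> y.
have ay : a < y by near: y; exact: lt_nbhsr.
rewrite /oriented_integral; case: ifPn => [y0|]; last rewrite -ltNge => y0.
  by rewrite (@Rintegral_split _ a 0 y)// ?ltW// addrAC subrr add0r.
by rewrite (@Rintegral_split _ a y 0)// ?ltW// opprD addrA subrr add0r.
Unshelve. all: by end_near. Qed.
End IntegralPrimitive.

(** * Functions of class C^k *)

Section SmoothFunctions.
Variables (R : realType) (U : normedModType R).
Implicit Types (f g : U -> R) (k : nat) (x v : U).

Lemma Ck_prev (W : normedModType R) k (f : U -> W) : Ck k.+1 f -> Ck k f.
Proof.
elim: k f => [|k IH] f [df cf] /=.
  by move=> x; exact: differentiable_continuous.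
by split=> // v; apply: IH; exact: cf.
Qed.

(** Lets the differential be given by a formula, so that membership in C^k is
    proved by recursion on k through the shape of the formula. *)
Lemma CkS (W : normedModType R) k (f : U -> W) (df : U -> U -> W) :
  (forall x, differentiable f x) -> (forall x v, 'd f x v = df x v) ->
  (forall v, Ck k (fun x => df x v)) -> Ck k.+1 f.
Proof.
move=> dif dfE cdf; split=> // v.
by rewrite (_ : (fun x => 'd f x v) = fun x => df x v)//; apply/funext => x.
Qed.

Lemma Ck_cst (W : normedModType R) k (w : W) : Ck k (fun _ : U => w).
Proof.
elim: k w => [|k IH] w; first exact: cst_continuous.
apply: (CkS (df := fun _ _ => 0)) => [x|x v|v]; [exact: differentiable_cst| |exact: IH].
by rewrite -[X in 'd X _]/(cst w) diff_cst.
Qed.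

Lemma CkD (W : normedModType R) k (f g : U -> W) :
  Ck k f -> Ck k g -> Ck k (fun x => f x + g x).
Proof.
elim: k f g => [|k IH] f g; first by move=> cf cg x; apply: cvgD; [exact: cf|exact: cg].
move=> [df cf] [dg cg].
apply: (CkS (df := fun x v => 'd f x v + 'd g x v)) => [x|x v|v].
- exact: differentiableD.
- by rewrite -[X in 'd X _]/(f + g) diffD.
- by apply: IH; [exact: cf|exact: cg].
Qed.

Lemma Ck_sum (W : normedModType R) k (I : Type) (r : seq I) (P : pred I)
  (f : I -> U -> W) : (forall i, P i -> Ck k (f i)) ->
  Ck k (fun x => \sum_(i <- r | P i) f i x).
Proof.
move=> cf; elim: r => [|i r IH].
  by under eq_fun do rewrite big_nil; exact: Ck_cst.
under eq_fun do rewrite big_cons.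
by case Pi: (P i) => //; apply: CkD => //; exact: cf.
Qed.

Lemma CkZl (W : normedModType R) k f (w : W) : Ck k f -> Ck k (fun x => f x *: w).
Proof.
elim: k f => [|k IH] f; first by move=> cf x; apply: cvgZr_tmp; exact: cf.
move=> [df cf]; apply: (CkS (df := fun x v => 'd f x v *: w)) => [x|x v|v].
- exact: differentiableZl.
- by rewrite diffZl.
- by apply: IH; exact: cf.
Qed.

Lemma CkM k f g : Ck k f -> Ck k g -> Ck k (fun x => f x * g x).
Proof.
elim: k f g => [|k IH] f g; first by move=> cf cg x; apply: cvgM; [exact: cf|exact: cg].
move=> [df cf] [dg cg].
apply: (CkS (df := fun x v => f x * 'd g x v + g x * 'd f x v)) => [x|x v|v].
- exact: differentiableM.
- by rewrite -[X in 'd X _]/(f * g) diffM.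
- by apply: CkD; apply: IH; [exact: Ck_prev|exact: cg|exact: Ck_prev|exact: cf].
Qed.

Lemma is_diff_comp1 f (phi : R -> R) x (a : R) : differentiable f x ->
  is_derive (f x) 1 phi a ->
  differentiable (fun x => phi (f x)) x /\
  forall v, 'd (fun x => phi (f x)) x v = a * 'd f x v.
Proof.
move=> df [dphi phi'].
have dphi' : differentiable phi (f x) by apply/derivable1_diffP.
split=> [|v]; first exact: differentiable_comp.
rewrite -[X in 'd X _]/(phi \o f) diff_comp//= diff1E// derive1E phi'.
by rewrite /GRing.scale/= mulrC.
Qed.

(** By the chain rule the differential of phi o f is phi'(f) df, so it is enough
    that composition with phi' preserves C^k. *)
Lemma Ck_comp (phi phi' : R -> R) :
  (forall y : R, is_derive y 1 phi (phi' y)) ->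
  (forall k f, Ck k (fun x => f x) -> Ck k (fun x => phi' (f x))) ->
  forall k f, Ck k f -> Ck k (fun x => phi (f x)).
Proof.
move=> dphi cphi' [|k] f cf.
  move=> x; apply: continuous_comp; first exact: cf.
  by have [/derivable1_diffP/differentiable_continuous] := dphi (f x).
have [df cdf] := cf.
have h x := is_diff_comp1 (df x) (dphi (f x)).
apply: (CkS (df := fun x v => phi' (f x) * 'd f x v)) => [x|x v|v].
- by have [] := h x.
- by have [_ ->] := h x.
- by apply: CkM; [apply: cphi'; exact: Ck_prev|exact: cdf].
Qed.

Lemma Ck_expR k f : Ck k f -> Ck k (fun x => expR (f x)).
Proof.
elim: k f => [|k IH] f cf.
  by move=> x; apply: continuous_comp; [exact: cf|exact: continuous_expR].
have [df cdf] := cf.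
have h x := is_diff_comp1 (df x) (is_derive_expR (f x)).
apply: (CkS (df := fun x v => expR (f x) * 'd f x v)) => [x|x v|v].
- by have [] := h x.
- by have [_ ->] := h x.
- by apply: CkM; [apply: IH; exact: Ck_prev|exact: cdf].
Qed.
End SmoothFunctions.

Lemma Ck_coord (R : realType) k m (j : 'I_m) :
  Ck k (fun x : 'rV[R]_m => x 0 j : R).
Proof.
pose f : 'rV[R]_m -> R := fun x => x 0 j.
have fl : linear f by move=> a u v; rewrite /f !mxE.
pose fL : {linear 'rV[R]_m -> R} := HB.pack f (GRing.isLinear.Build _ _ _ _ _ fl).
case: k => [|k]; first exact: coord_continuous.
apply: (@CkS R 'rV[R]_m R k f (fun _ v => v 0 j)) => [x|x v|v].
- exact: differentiable_coord.
- by rewrite -[X in 'd X _]/(fL : _ -> _) diff_lin//; exact: coord_continuous.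
- exact: Ck_cst.
Qed.

Lemma Ck_row (R : realType) (U : normedModType R) k m (f : 'I_m -> U -> R) :
  (forall j, Ck k (f j)) -> Ck k (fun x => \row_j f j x).
Proof.
move=> cf; rewrite (_ : (fun x => _) = fun x => \sum_j f j x *: delta_mx 0 j).
  by apply: Ck_sum => j _; exact: CkZl.
by apply/funext => x; rewrite [LHS]row_sum_delta; apply: eq_bigr => j _; rewrite mxE.
Qed.

Lemma diff_coord (R : realType) (U : normedModType R) m (F : U -> 'rV[R]_m) x j v :
  differentiable F x -> 'd (fun y => F y 0 j : R) x v = 'd F x v 0 j.
Proof.
move=> dF; pose f : 'rV[R]_m -> R := fun x => x 0 j.
have fl : linear f by move=> a u w; rewrite /f !mxE.
pose fL : {linear 'rV[R]_m -> R} := HB.pack f (GRing.isLinear.Build _ _ _ _ _ fl).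
have e y : 'd f y = f :> (_ -> _).
  by rewrite -[X in 'd X _]/(fL : _ -> _) diff_lin//; exact: coord_continuous.
rewrite -[X in 'd X _]/(f \o F) diff_comp//=; last exact: differentiable_coord.
by rewrite e.
Qed.

(** * The map in length coordinates *)

Section LengthCoordinates.
Variables (R : realType) (T : triangulated_surface) (h : R).
Local Notation F := (tri_F T).
Local Notation E := (tri_E T).
Local Notation lengths := 'rV[R]_#|tri_E T|.
Implicit Types (f : F) (i k : 'I_3) (l w : lengths).

Definition ell l f i : R := l 0 (enum_rank (tri_edge (f, i))).

Definition angle l f i : R :=
  expR ((ell l f i - ell l f (ordS i) - ell l f (ord_pred i)) / 2).

Definition excess l f i : R :=
  (angle l f (ordS i) + angle l f (ord_pred i) - angle l f i) / 2.

Definition exp_integral (x : R) : R := oriented_integral 0 x (fun t => expR (h * t ^+ 2)).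

Definition Phi l : lengths :=
  \row_j \sum_(s : F * 'I_3 | tri_edge s == enum_val j) exp_integral (excess l s.1 s.2).

(** The cosine law of decorated ideal triangles: corner angles are the exponentials
    [angle] of half-sums of lengths. *)
Lemma PsiE (dr : decorated_teichmueller_space R T) : Psi h dr = Phi (length_map dr).
Proof.
have [Bd _] := horodisksP dr; have [Bn _] := is_decorationP Bd.
have aE f k : corner_angle (horodisks dr) f k = angle (length_map dr) f k.
  rewrite corner_angleE// !lambda_length_map -expRD -expRN -expRD /angle /ell.
  by congr expR; ring.
apply/rowP => j; rewrite !mxE; apply: eq_bigr => s _.
by rewrite /= !aE.
Qed.

Lemma is_derive_exp_integral (x : R) : is_derive x 1 exp_integral (expR (h * x ^+ 2)).
Proof.
apply: is_derive_oriented_integral => t.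
apply: continuous_comp; last exact: continuous_expR.
apply: cvgM; first exact: cvg_cst.
exact: exprn_continuous.
Qed.


Definition dangle l w f i : R :=
  angle l f i * ((ell w f i - ell w f (ordS i) - ell w f (ord_pred i)) / 2).

Definition dexcess l w f i : R :=
  (dangle l w f (ordS i) + dangle l w f (ord_pred i) - dangle l w f i) / 2.

Definition dPhi l w (j : 'I_#|E|) : R :=
  \sum_(s : F * 'I_3 | tri_edge s == enum_val j)
    expR (h * excess l s.1 s.2 ^+ 2) * dexcess l w s.1 s.2.

Lemma is_derive_Phi (q : R -> lengths) w (t : R) :
  (forall j, is_derive t 1 (fun t => q t 0 j : R) (w 0 j)) ->
  forall j, is_derive t 1 (fun t => Phi (q t) 0 j : R) (dPhi (q t) w j).
Proof.
move=> dq j.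
have da f i : is_derive t 1 (fun t => angle (q t) f i) (dangle (q t) w f i).
  rewrite /angle /dangle; have d0 := dq (enum_rank (tri_edge (f, i))).
  have d1 := dq (enum_rank (tri_edge (f, ordS i))).
  have d2 := dq (enum_rank (tri_edge (f, ord_pred i))).
  have dl : is_derive t 1 (fun t => (ell (q t) f i - ell (q t) f (ordS i)
      - ell (q t) f (ord_pred i)) / 2)
      ((ell w f i - ell w f (ordS i) - ell w f (ord_pred i)) / 2).
    by rewrite /ell; apply: is_derive_eq; rewrite /GRing.scale/=; ring.
  exact: (is_derive1_comp (is_derive_expR _) dl).
have de f i : is_derive t 1 (fun t => excess (q t) f i) (dexcess (q t) w f i).
  have d0 := da f i; have d1 := da f (ordS i); have d2 := da f (ord_pred i).
  by rewrite /excess; apply: is_derive_eq; rewrite /GRing.scale/= /dexcess; ring.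
have dp (s : F * 'I_3) : is_derive t 1 (fun t => exp_integral (excess (q t) s.1 s.2))
    (expR (h * excess (q t) s.1 s.2 ^+ 2) * dexcess (q t) w s.1 s.2).
  exact: (is_derive1_comp (is_derive_exp_integral _) (de _ _)).
rewrite (_ : (fun t => _) = fun t => \sum_(s : F * 'I_3 | tri_edge s == enum_val j)
    exp_integral (excess (q t) s.1 s.2)); last by apply/funext => t'; rewrite mxE.
rewrite /dPhi; elim: (index_enum _) => [|s r IH].
  under eq_fun do rewrite big_nil; rewrite big_nil; exact: is_derive_cst.
under eq_fun do rewrite big_cons; rewrite big_cons.
case: ifP => // _.
exact: (is_deriveD (dp s) IH).
Qed.

Lemma Ck_Phi n : Ck n Phi.
Proof.
apply: Ck_row => j; apply: Ck_sum => s _.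
have Cl f i : Ck n (fun l : lengths => ell l f i : R) by exact: Ck_coord.
have CM (c : R) (u : lengths -> R) : Ck n u -> Ck n (fun l => u l * c).
  by move=> Cu; apply: CkM => //; exact: Ck_cst.
have CN (u : lengths -> R) : Ck n u -> Ck n (fun l => - u l).
  move=> /(CM (-1)) Cu; rewrite (_ : (fun l => _) = fun l => u l * -1)//.
  by apply/funext => l; rewrite mulrN1.
have Ca f i : Ck n (fun l => angle l f i).
  apply: Ck_expR; apply: CM.
  by apply: CkD; [apply: CkD; [|apply: CN]|apply: CN]; exact: Cl.
have Ce f i : Ck n (fun l => excess l f i).
  by apply: CM; apply: CkD; [apply: CkD|apply: CN]; exact: Ca.
apply: (Ck_comp is_derive_exp_integral) => // k u Cu.
apply: Ck_expR; apply: CkM; first exact: Ck_cst.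
rewrite (_ : (fun x => _) = fun x => u x * u x); first exact: CkM.
by apply/funext => x; rewrite expr2.
Qed.


(** The derivative of the new coordinate u with respect to the length; chosen so
    that [weight_excess] holds. *)
Definition weight (x : R) : R := expR (- h * expR (- x)).

Lemma weight_gt0 x : 0 < weight x. Proof. exact: expR_gt0. Qed.

Lemma angleM l f i :
  angle l f (ordS i) * angle l f (ord_pred i) = expR (- ell l f i).
Proof.
rewrite /angle -expRD ordSS ordSK ord_predK ord_pred_pred.
by congr expR; field.
Qed.

(** Since the product of the angles at the ends of the edge j is exp(- l_j), the
    difference x_j^2 - exp(- l_j) is a symmetric function of the three angles. *)
Lemma weight_excess l f i k :
  weight (ell l f i) * expR (h * excess l f i ^+ 2)
  = weight (ell l f k) * expR (h * excess l f k ^+ 2).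
Proof.
suff cst j : excess l f j ^+ 2 - expR (- ell l f j)
    = ((\sum_m angle l f m) ^+ 2 - 4 * (\sum_m expR (- ell l f m))) / 4.
  rewrite /weight -!expRD; congr expR.
  transitivity (h * (excess l f i ^+ 2 - expR (- ell l f i))); first by ring.
  by rewrite (etrans (cst i) (esym (cst k))); ring.
rewrite !(sum_ord3 _ j) -!angleM /excess ordSS ordSK ord_predK ord_pred_pred.
by field.
Qed.

(** The derivative of the angle a_k along w is - a_k / 2 times
    w_i + w_j - w_k; collecting the terms with a_k gives - a_k / 4 times
    the square of the same linear form. *)
Lemma sum_dexcess l w f : \sum_i ell w f i * dexcess l w f i
  = - \sum_i angle l f i / 4
        * (ell w f (ordS i) + ell w f (ord_pred i) - ell w f i) ^+ 2.
Proof.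
rewrite !(sum_ord3 _ ord0) /dexcess /dangle.
rewrite !(ordSS, ordSK, ord_predK, ord_pred_pred).
by field.
Qed.

(** Every side of a triangle belongs to exactly one edge. *)
Lemma sum_edges (G : F * 'I_3 -> R) :
  \sum_(j < #|E|) \sum_(s | tri_edge s == enum_val j) G s = \sum_f \sum_i G (f, i).
Proof.
rewrite pair_big/= (eq_bigr (fun s => G s)); last by case.
rewrite (exchange_big_dep xpredT)//=; apply: eq_bigr => s _.
rewrite (big_pred1 (enum_rank (tri_edge s)))// => j.
by rewrite /= -{1}(enum_rankK (tri_edge s)) (inj_eq enum_val_inj) eq_sym.
Qed.

(** Grouping by triangles, [weight_excess] and [sum_dexcess] give minus a sum of
    squares with positive coefficients.  It vanishes only if
    w_i + w_j = w_k for all edges k of all triangles, that is if w = 0. *)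
Lemma dPhi_negative l w : w != 0 ->
  \sum_j weight (l 0 j) * w 0 j * dPhi l w j < 0.
Proof.
move=> w0.
pose c f := weight (ell l f ord0) * expR (h * excess l f ord0 ^+ 2).
pose q f := \sum_i angle l f i / 4
        * (ell w f (ordS i) + ell w f (ord_pred i) - ell w f i) ^+ 2.
have -> : \sum_j weight (l 0 j) * w 0 j * dPhi l w j = - \sum_f c f * q f.
  transitivity (\sum_f \sum_i weight (ell l f i) * ell w f i
      * (expR (h * excess l f i ^+ 2) * dexcess l w f i)).
    rewrite -(sum_edges (fun s => weight (ell l s.1 s.2) * ell w s.1 s.2
      * (expR (h * excess l s.1 s.2 ^+ 2) * dexcess l w s.1 s.2))).
    apply: eq_bigr => j _; rewrite /dPhi mulr_sumr; apply: eq_bigr => -[f i] /eqP e.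
    by rewrite /ell e enum_valK.
  rewrite -sumrN; apply: eq_bigr => f _; rewrite -mulrN -sum_dexcess mulr_sumr.
  apply: eq_bigr => i _; rewrite /c -(weight_excess l f i); ring.
rewrite oppr_lt0.
have c0 f : 0 < c f by apply: mulr_gt0; [exact: weight_gt0|exact: expR_gt0].
have q0 f i : 0 <= angle l f i / 4
        * (ell w f (ordS i) + ell w f (ord_pred i) - ell w f i) ^+ 2.
  by apply: mulr_ge0; [apply: divr_ge0; [exact: expR_ge0|]|exact: sqr_ge0].
have qc f : 0 <= c f * q f.
  by apply: mulr_ge0; [exact: ltW|apply: sumr_ge0 => i _; exact: q0].
rewrite lt_neqAle sumr_ge0// andbT eq_sym psumr_neq0//.
have [j wj] : exists j, w 0 j != 0.
  apply/existsP; apply: contraNT w0; rewrite negb_exists => /forallP w0.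
  by apply/eqP/rowP => j; rewrite mxE; apply/eqP; rewrite -[_ == _]negbK.
have [[f i] /eqP e] := tri_edge_surj (enum_val j).
have {}wj : ell w f i != 0 by rewrite /ell e enum_valK.
apply/hasP; exists f; first by rewrite mem_index_enum.
rewrite /= pmulr_rgt0 ?c0// lt_neqAle sumr_ge0// andbT eq_sym.
apply: contraNneq wj => /eqP.
rewrite psumr_eq0// => /allP m0.
have m k : ell w f (ordS k) + ell w f (ord_pred k) - ell w f k = 0.
  have := m0 k (mem_index_enum k).
  by rewrite /= mulf_eq0 sqrf_eq0 gt_eqF ?divr_gt0 ?expR_gt0//= => /eqP.
have := m (ordS i); have := m (ord_pred i); rewrite ordSS ordSK ord_predK ord_pred_pred.
by move=> e1 e2; apply/eqP; lra.
Qed.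
End LengthCoordinates.

(** * Monotonicity and embedding *)

Section Embedding.
Variables (R : realType) (T : triangulated_surface) (h : R).
Local Notation E := (tri_E T).
Local Notation lengths := 'rV[R]_#|tri_E T|.
Implicit Types (l w : lengths) (a b t x y : R).
Local Notation weight := (@weight R h).
Local Notation Phi := (@Phi R T h).

(** The coordinate u of an edge of length x. *)
Definition ucoord x : R := oriented_integral 0 x weight.

Lemma is_derive_ucoord x : is_derive x 1 ucoord (weight x).
Proof.
apply: is_derive_oriented_integral => t.
apply: continuous_comp; last exact: continuous_expR.
apply: cvgM; first exact: cvg_cst.
apply: continuous_comp; last exact: continuous_expR.
exact: continuousN.
Qed.

Lemma continuous_ucoord : continuous ucoord.
Proof.
move=> x; apply/differentiable_continuous/derivable1_diffP.
by have [] := is_derive_ucoord x.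
Qed.

Lemma ucoord_lt x y : x < y -> ucoord x < ucoord y.
Proof.
move=> xy; have [||c _ e] := @MVT R ucoord weight x y xy.
- by move=> z _; exact: is_derive_ucoord.
- by apply: continuous_subspaceT; exact: continuous_ucoord.
- by rewrite -subr_gt0 e mulr_gt0 ?weight_gt0// subr_gt0.
Qed.

Lemma ucoord_mono : {mono ucoord : x y / x <= y}.
Proof. by apply: le_mono => x y; exact: ucoord_lt. Qed.

Lemma ucoord_inj : injective ucoord.
Proof. exact: inc_inj ucoord_mono. Qed.

Definition ucoordV y : R := xget 0 [set x | ucoord x = y].

Lemma ucoordK : cancel ucoord ucoordV.
Proof.
move=> x; apply: ucoord_inj.
exact: (@xgetPex _ 0 [set z | ucoord z = ucoord x] (ex_intro _ x erefl)).
Qed.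

(** The straight segment from a to b in the coordinate u. *)
Definition upath a b t : R := ucoordV ((1 - t) * ucoord a + t * ucoord b).

(** The range of [ucoord] need not be all of R, but it is an interval: the
    intermediate value theorem puts convex combinations in it. *)
Lemma ucoord_upath a b t : 0 <= t <= 1 ->
  ucoord (upath a b t) = (1 - t) * ucoord a + t * ucoord b.
Proof.
move=> /andP[t0 t1]; rewrite /upath.
wlog ab : a b t t0 t1 / a <= b => [wl|].
  have [|/ltW ba] := leP a b; first exact: wl.
  rewrite addrC -{1 3}[t](subKr 1); apply: wl => //.
    by rewrite subr_ge0.
  by rewrite gerBl.
have cab := ucoord_mono a b; rewrite ab in cab.
have [||c _ <-] := @IVT R ucoord a b ((1 - t) * ucoord a + t * ucoord b) ab.
- by apply: continuous_subspaceT; exact: continuous_ucoord.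
- rewrite (min_idPl cab) (max_idPr cab); apply/andP; split; nra.
by rewrite ucoordK.
Qed.

Lemma is_derive_upath a b t : 0 <= t <= 1 ->
  is_derive t 1 (upath a b) ((ucoord b - ucoord a) / weight (upath a b t)).
Proof.
move=> t01; pose c := upath a b t.
have dV : is_derive (ucoord c) 1 ucoordV (weight c)^-1.
  apply: (@is_derive_inverse R ucoord).
  - by near=> z; exact: ucoordK.
  - by near=> z; exact: continuous_ucoord.
  - exact: is_derive_ucoord.
  - by rewrite lt0r_neq0// weight_gt0.
rewrite ucoord_upath// in dV.
have dl : is_derive t 1 (fun t => (1 - t) * ucoord a + t * ucoord b) (ucoord b - ucoord a).
  by apply: is_derive_eq; rewrite /GRing.scale/=; ring.
rewrite mulrC.
exact: (@is_derive1_comp R ucoordV (fun t => (1 - t) * ucoord a + t * ucoord b)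
  t _ _ dV dl).
Unshelve. all: by end_near. Qed.

Lemma upath0 a b : upath a b 0 = a.
Proof. by rewrite /upath subr0 mul1r mul0r addr0 ucoordK. Qed.

Lemma upath1 a b : upath a b 1 = b.
Proof. by rewrite /upath subrr mul1r mul0r add0r ucoordK. Qed.

(** Along the segment straight in u, the pairing of Phi with the direction of the
    segment has a negative derivative by [dPhi_negative]. *)
Lemma Phi_monotone l l' : l != l' ->
  \sum_j (Phi l' 0 j - Phi l 0 j) * (ucoord (l' 0 j) - ucoord (l 0 j)) < 0.
Proof.
move=> ll'; pose c j := ucoord (l' 0 j) - ucoord (l 0 j).
pose q t : lengths := \row_j upath (l 0 j) (l' 0 j) t.
(* the velocity of q, which is the constant c in the coordinates u *)
pose w t : lengths := \row_j (c j / weight (q t 0 j)).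
pose f t := \sum_j Phi (q t) 0 j * c j.
pose df t := \sum_j dPhi h (q t) (w t) j * c j.
have q0 : q 0 = l by apply/rowP => j; rewrite mxE upath0.
have q1 : q 1 = l' by apply/rowP => j; rewrite mxE upath1.
have dPhi_q t : 0 <= t <= 1 ->
    forall j, is_derive t 1 (fun t => Phi (q t) 0 j) (dPhi h (q t) (w t) j).
  move=> t01; apply: is_derive_Phi => j.
  rewrite (_ : (fun t => _) = upath (l 0 j) (l' 0 j)); last first.
    by apply/funext => t'; rewrite mxE.
  by rewrite !mxE; exact: is_derive_upath.
have d t : 0 <= t <= 1 -> is_derive t 1 f (df t).
  move=> /dPhi_q dq; rewrite /f /df; elim: (index_enum _) => [|j r IH].
    under eq_fun do rewrite big_nil; rewrite big_nil; exact: is_derive_cst.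
  under eq_fun do rewrite big_cons; rewrite big_cons.
  apply: (is_deriveD _ IH); have dqj := dq j.
  by apply: is_derive_eq; rewrite /GRing.scale/=; ring.
have [||t] := @MVT R f df 0 1 ltr01.
- by move=> t /[!in_itv]/= /andP[/ltW t0 /ltW t1]; apply: d; rewrite t0.
- apply: continuous_in_subspaceT => t; rewrite inE /= in_itv/= => /d[+ _].
  by move=> /derivable1_diffP/differentiable_continuous.
rewrite in_itv/= => /andP[/ltW t0 /ltW t1]; rewrite subr0 mulr1 => e.
have -> : \sum_j (Phi l' 0 j - Phi l 0 j) * (ucoord (l' 0 j) - ucoord (l 0 j))
    = f 1 - f 0.
  by rewrite /f q0 q1 -sumrB; apply: eq_bigr => j _; rewrite mulrBl.
rewrite e /df {e d}.
have wne0 : w t != 0.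
  apply: contraNneq ll' => wt; apply/eqP/rowP => j; apply/ucoord_inj/eqP.
  have /rowP/(_ j) := wt; rewrite mxE [in RHS]mxE => /eqP.
  rewrite mulf_eq0 invr_eq0 (gt_eqF (weight_gt0 _ _)) orbF subr_eq0.
  by rewrite eq_sym.
rewrite (eq_bigr (fun j => weight (q t 0 j) * w t 0 j * dPhi h (q t) (w t) j)).
  exact: dPhi_negative.
move=> j _; have -> : w t 0 j = c j / weight (q t 0 j) by rewrite mxE.
have := lt0r_neq0 (weight_gt0 h (q t 0 j)).
move: (weight (q t 0 j)) (dPhi _ _ _ _) (c j) => W D C W0.
by rewrite [W * _]mulrC mulfVK// mulrC.
Qed.

Lemma ler_norm_coord (n : nat) (v : 'rV[R]_n) j : `|v 0 j| <= `|v|.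
Proof.
have : `|v ord0 j| <= `|v|.
  rewrite -[X in _ <= X]/(mx_norm v) mx_normrE.
  exact: (le_bigmax _ (fun i => `|v i.1 i.2|) (ord0, j)).
by rewrite (_ : ord0 = 0).
Qed.

Lemma continuous_Phi : continuous Phi.
Proof. exact: (Ck_Phi T h 0). Qed.

(** Let K be the sphere around l0 of small radius in the coordinates u.  For l
    outside of it, the segment from l0 to l crosses K at a point p; by
    monotonicity the pairing of Phi l0 - Phi l with the direction of the segment
    is at least that of Phi l0 - Phi p, which has a positive minimum on the
    compact set K. *)
Lemma Phi_inverse_continuous l0 (d : R) : 0 < d -> exists2 e : R, 0 < e &
  forall l, `|Phi l - Phi l0| < e -> `|l - l0| < d.
Proof.
move=> d0.
pose cc l : lengths := \row_j ucoord (l 0 j).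
pose N l := `|cc l - cc l0|.
pose gap l := \sum_j (Phi l0 0 j - Phi l 0 j) * (ucoord (l 0 j) - ucoord (l0 0 j)).
have Ccoord j : continuous (fun l : lengths => ucoord (l 0 j)).
  move=> l; apply: continuous_comp; first exact: coord_continuous.
  exact: continuous_ucoord.
have Ccc : continuous cc by apply: (Ck_row (k := 0)) => j; exact: Ccoord.
have CN : continuous N.
  move=> l; apply: (@continuous_comp _ _ _ (fun l => cc l - cc l0) Num.norm).
    exact: (@CkD R lengths lengths 0 cc (fun=> - cc l0) Ccc (@Ck_cst _ _ _ 0 _)).
  exact: norm_continuous.
have CPhi j : continuous (fun l => Phi l 0 j).
  move=> l; apply: (@continuous_comp _ _ _ Phi (fun v : lengths => v 0 j : R)).
    exact: continuous_Phi.
  exact: coord_continuous.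
have CB (u v : lengths -> R) : continuous u -> continuous v ->
    continuous (fun l => u l - v l).
  by move=> cu cv l; exact: (cvgB (cu l) (cv l)).
have Ccst (a : R) : continuous (fun _ : lengths => a) by exact: cst_continuous.
have Cgap : continuous gap.
  apply: (Ck_sum (k := 0)) => j _.
  exact: (@CkM R lengths 0 _ _ (CB _ _ (Ccst _) (CPhi j)) (CB _ _ (Ccoord j) (Ccst _))).
have gap_gt0 l : l != l0 -> 0 < gap l.
  move=> ll0; rewrite /gap -oppr_lt0 -sumrN.
  under eq_bigr do rewrite -mulNr opprB.
  by apply: Phi_monotone; rewrite eq_sym.
(* any point of u-distance less than r j has l-distance less than d *)
pose r j := Num.min (ucoord (l0 0 j + d) - ucoord (l0 0 j))
                    (ucoord (l0 0 j) - ucoord (l0 0 j - d)).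
have r0 j : 0 < r j by rewrite lt_min !subr_gt0 !ucoord_lt// ?ltrDl// gtrBl.
have rP l j : `|ucoord (l 0 j) - ucoord (l0 0 j)| < r j -> `|l 0 j - l0 0 j| < d.
  rewrite lt_min !ltr_norml => /andP[/andP[_ h1] /andP[h2 _]].
  have {}h1 : ucoord (l 0 j) < ucoord (l0 0 j + d) by lra.
  have {}h2 : ucoord (l0 0 j - d) < ucoord (l 0 j) by lra.
  rewrite (leW_mono ucoord_mono) in h1; rewrite (leW_mono ucoord_mono) in h2.
  by apply/andP; split; lra.
(* halved because the points of K are at u-distance exactly e *)
pose e := (\big[Num.min/1]_j r j) / 2.
have e0 : 0 < e by rewrite divr_gt0//; apply: lt_bigmin => // j _; exact: r0.
have er j : e < r j.
  apply: (@lt_le_trans _ _ (\big[Num.min/1]_j r j)); last exact: bigmin_le.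
  by rewrite /e; move: e0; rewrite /e; lra.
have Nd l : N l <= e -> `|l - l0| < d.
  move=> Nl; rewrite -[X in X < _]/(mx_norm (l - l0)) mx_normrE.
  apply: bigmax_lt => //= -[i j] _ /=.
  rewrite !mxE ord1; apply: rP; apply: le_lt_trans (er j); apply: le_trans Nl.
  by have := ler_norm_coord (cc l - cc l0) j; rewrite !mxE.
pose K := [set l | N l = e].
have Kc : compact K.
  apply: bounded_closed_compact.
    exists (`|l0| + d); split; first exact: num_real.
    move=> M dM l Kl; have h1 := ler_normD (l - l0) l0; rewrite subrK in h1.
    have h2 : `|l - l0| < d by apply: Nd; rewrite [N l]Kl.
    apply: le_trans h1 _; apply/ltW; apply: lt_trans dM.
    by rewrite addrC ltrD2l.
  rewrite (_ : K = N @^-1` [set x | x = e])//.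
  by apply: closed_comp; [move=> l _; exact: CN|exact: closed_eq].
(* the segment from l0 to l meets K at time t l *)
pose t l := e / N l.
pose p l : lengths := \row_j upath (l0 0 j) (l 0 j) (t l).
have far l : ~~ (`|l - l0| < d) -> [/\ 0 < t l, t l <= 1, K (p l) &
    forall j, ucoord (p l 0 j) - ucoord (l0 0 j)
      = t l * (ucoord (l 0 j) - ucoord (l0 0 j))].
  move=> ld; have Nl : e < N l by rewrite ltNge; apply: contra ld => /Nd.
  have N0 : 0 < N l by exact: lt_trans Nl.
  have t0 : 0 < t l by rewrite divr_gt0.
  have t1 : t l <= 1 by rewrite ler_pdivrMr// mul1r ltW.
  have pE j : ucoord (p l 0 j) - ucoord (l0 0 j)
      = t l * (ucoord (l 0 j) - ucoord (l0 0 j)).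
    by rewrite mxE ucoord_upath ?t1 ?ltW//; ring.
  split=> //; rewrite /K /= /N.
  have -> : cc (p l) - cc l0 = t l *: (cc l - cc l0).
    apply/rowP => j; rewrite [RHS]mxE; transitivity (ucoord (p l 0 j) - ucoord (l0 0 j)).
      by rewrite !mxE.
    by rewrite pE !mxE.
  by rewrite normrZ gtr0_norm// -/(N l) /t mulfVK// lt0r_neq0.
have [[p0 Kp0]|K0] := pselect (exists p, K p); last first.
  exists 1 => // l _; apply/negPn/negP => /far[_ _ Kp _].
  by apply: K0; exists (p l).
have [c Kc' cmin] := EVT_min_rV (ex_intro _ p0 Kp0) Kc
  (continuous_subspaceT Cgap).
rewrite inE in Kc'.
have m0 : 0 < gap c.
  apply: gap_gt0; apply: contraTneq e0 => cl0.
  by rewrite -[e]Kc' cl0 /N subrr normr0 ltxx.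
(* the u-coordinates of points of K are within e of those of l0; the term 1
   avoids a division by 0 *)
have n0 : 0 < #|E|%:R * e + 1 by rewrite ltr_wpDl// mulr_ge0// ltW.
exists (gap c / (#|E|%:R * e + 1)); first by rewrite divr_gt0.
move=> l lc; apply/negPn/negP => ld; have [t0 t1 Kp pE] := far l ld.
have mp : gap c <= gap (p l) by apply: cmin; rewrite inE.
pose S := \sum_j (Phi l0 0 j - Phi l 0 j) * (ucoord (p l 0 j) - ucoord (l0 0 j)).
have pS : gap (p l) <= S.
  rewrite -subr_ge0 /S /gap -sumrB.
  pose A := \sum_j (Phi (p l) 0 j - Phi l 0 j) * (ucoord (l 0 j) - ucoord (l0 0 j)).
  rewrite (_ : \sum_j _ = t l * A); last first.
    have alg (x y z s u : R) :
        (x - y) * (s * u) - (x - z) * (s * u) = s * ((z - y) * u) by ring.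
    by rewrite /A mulr_sumr; apply: eq_bigr => j _; rewrite pE; exact: alg.
  apply: mulr_ge0; first exact: ltW.
  have [pl|pl] := eqVneq (p l) l.
    by rewrite /A pl big1// => j _; rewrite subrr mul0r.
  have : 0 < (1 - t l) * A.
    rewrite /A mulr_sumr -oppr_lt0 -sumrN.
    rewrite (eq_bigr (fun j => (Phi l 0 j - Phi (p l) 0 j)
        * (ucoord (l 0 j) - ucoord (p l 0 j)))); first exact: Phi_monotone.
    move=> j _; have -> : ucoord (l 0 j) - ucoord (p l 0 j)
        = (1 - t l) * (ucoord (l 0 j) - ucoord (l0 0 j)).
      by rewrite mulrBl mul1r -pE opprB addrA subrK.
    have alg (x y s u : R) : - (s * ((x - y) * u)) = (y - x) * (s * u) by ring.
    exact: alg.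
  have t1' : 0 <= 1 - t l by rewrite subr_ge0.
  move=> h1; rewrite leNgt; apply/negP => A0.
  by move: h1; rewrite ltNge mulr_ge0_le0// ltW.
have SN : S <= #|E|%:R * e * `|Phi l - Phi l0|.
  apply: (@le_trans _ _ (\sum_(j < #|E|) e * `|Phi l - Phi l0|)); last first.
    by rewrite sumr_const card_ord -mulrA mulr_natl.
  apply: ler_sum => j _; apply: le_trans (ler_norm _) _; rewrite normrM mulrC.
  apply: ler_pM => //.
    have := ler_norm_coord (cc (p l) - cc l0) j; rewrite -/(N (p l)) [N _]Kp.
    by rewrite !mxE.
  have sub (u v : lengths) : (u - v) 0 j = u 0 j - v 0 j by rewrite !mxE.
  by have := ler_norm_coord (Phi l0 - Phi l) j; rewrite [X in _ <= X]distrC sub.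
have := le_trans (le_trans mp pS) SN.
move: lc; rewrite ltr_pdivlMr// => lc h1.
have := lt_le_trans lc h1.
by rewrite mulrDr mulr1 [X in X + _]mulrC gtrDl normr_lt0.
Qed.

(** Restrict Phi to the line through l with direction w. *)
Lemma diff_Phi l w j : 'd Phi l w 0 j = dPhi h l w j.
Proof.
have dP l' : differentiable Phi l' by have [] := Ck_Phi T h 1.
pose q t : lengths := l + t *: w.
pose z (t : R) : lengths := t *: w.
have hs : is_diff (0 : R) z z := is_diff_scalel 0 w.
have hq : is_diff (0 : R) q (0 + z) := is_diffD (is_diff_cst l 0) hs.
have [dq dqE] := hq.
have qd : 'd q 0 1 = w.
  transitivity ((0 + z) 1); first by rewrite dqE.
  by rewrite -[LHS]/(0 + 1 *: w) add0r scale1r.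
have q0 : q 0 = l by rewrite /q scale0r addr0.
pose c (l : lengths) : R := Phi l 0 j.
have dc : differentiable c (q 0).
  apply: (@differentiable_comp _ _ _ _ Phi (fun v : lengths => v 0 j : R)) => //.
  exact: differentiable_coord.
have e1 : 'd (c \o q) 0 1 = 'd c (q 0) ('d q 0 1) by rewrite diff_comp.
have e2 : 'd c l w = 'd Phi l w 0 j := diff_coord j w (dP l).
have dcq : differentiable (c \o q) 0 := differentiable_comp dq dc.
rewrite qd q0 e2 in e1.
have h1 : is_derive (0 : R) 1 (c \o q) ('d Phi l w 0 j).
  split; first exact/derivable1_diffP.
  by rewrite deriveE.
have h2 : is_derive (0 : R) 1 (c \o q) (dPhi h (q 0) w j).
  apply: is_derive_Phi => i.
  rewrite (_ : (fun t => _) = fun t => l 0 i + t * w 0 i); last first.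
    by apply/funext => t; rewrite !mxE.
  by apply: is_derive_eq; rewrite /GRing.scale/=; ring.
by case: h1 h2 => _ <- [_ ->]; rewrite q0.
Qed.

Lemma Phi_smooth_embedding : smooth_embedding Phi.
Proof.
split; first by move=> k; exact: Ck_Phi.
  move=> l v v' e; apply/eqP; rewrite -subr_eq0; apply: contraT => vv'.
  have := dPhi_negative h l vv'; rewrite big1 ?ltxx// => j _.
  have -> : dPhi h l (v - v') j = 0.
    by rewrite -diff_Phi linearB/= e subrr mxE.
  by rewrite mulr0.
split; [|exact: continuous_Phi|].
  move=> l l' e; apply/eqP; apply: contraT => /Phi_monotone.
  have -> : \sum_j (Phi l' 0 j - Phi l 0 j) * (ucoord (l' 0 j) - ucoord (l 0 j)) = 0.
    have Phi0 j : Phi l' 0 j - Phi l 0 j = 0 by rewrite e; exact: subrr.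
    by apply: big1 => j _; rewrite Phi0; exact: mul0r.
  by rewrite ltxx.
move=> A oA.
have ballC (x y : lengths) (e : R) : ball x e y <-> `|y - x| < e.
  by rewrite -ball_normE /= distrC.
pose small l (e : R) := 0 < e /\ forall l', ball (Phi l) e (Phi l') -> A l'.
exists (\bigcup_(le in [set le : lengths * R | A le.1 /\ small le.1 le.2])
          ball (Phi le.1) le.2).
  by apply: bigcup_open => -[l e] [_ [e0 _]]; exact: ball_open.
rewrite eqEsubset; split=> [_ [l Al <-]|y [[[l e] /= [Al [e0 lP]] bl] [l' _ el']]].
  split; last by exists l.
  have /nbhs_ballP[d /= d0 dA] : nbhs l A by exact: open_nbhs_nbhs.
  have [e e0 eP] := Phi_inverse_continuous l d0.
  exists (l, e); last exact: ballxx.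
  by split=> //; split=> // l' /ballC/eP h'; apply: dA; apply/ballC.
by exists l' => //; apply: lP; rewrite [Phi l']el'.
Qed.
End Embedding.

Theorem theorem1p1 (R : realType) (T : triangulated_surface)
    (chi_neg : punctured_euler_char T < 0) (h : R) :
  smooth_embedding_in_chart (@length_map R T) (@Psi R T h).
Proof.
have /choice[psi psiK] := @length_map_surj R T.
exists psi; split; [|exact: psiK|].
  by move=> dr; apply: length_map_inj; exact: psiK.
have -> : @Psi R T h \o psi = @Phi R T h.
  apply/funext => l.
  exact: etrans (PsiE h (psi l)) (congr1 (@Phi R T h) (psiK l)).
exact: Phi_smooth_embedding.
Qed.
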